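(* Let $a,b,c>0$. The smallest non-zero eigenvalue $\lambda_1$ of the Hodge-Laplacian $\Delta_1=d\delta+\delta d$ acting on $1$-forms is given by $$\lambda_1(\mathrm{SU}(2),g_{(a,b,c)})=\min\left(\frac{4b^2c^2}{a^2},\frac{4a^2c^2}{b^2},\frac{4a^2b^2}{c^2},\,a^2+b^2+c^2\right),$$ $$\lambda_1(\mathrm{SO}(3),g_{(a,b,c)})=\min\left(\frac{4b^2c^2}{a^2},\frac{4a^2c^2}{b^2},\frac{4a^2b^2}{c^2}\right).$$
   Context: Basis of $\mathfrak{su}(2)$: $E_1=\begin{pmatrix}\mathrm i&0\\0&-\mathrm i\end{pmatrix}$, $E_2=\begin{pmatrix}0&1\\-1&0\end{pmatrix}$, $E_3=\begin{pmatrix}0&\mathrm i\\\mathrm i&0\end{pmatrix}$, so $[E_1,E_2]=2E_3$, $[E_2,E_3]=2E_1$, $[E_3,E_1]=2E_2$. For $a,b,c>0$, $g_{(a,b,c)}$ is the left-invariant Riemannian metric on $\mathrm{SU}(2)$ for which $aE_1,bE_2,cE_3$ is orthonormal; the same notation is used for the induced left-invariant metric on $\mathrm{SO}(3)\cong\mathrm{SU}(2)/\{\pm\mathrm{Id}\}$. *)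

(* Defs.v *)
From HB Require Import structures.
From mathcomp Require Import all_boot all_order all_algebra.
From mathcomp Require Import complex.
From mathcomp Require Import all_classical all_reals all_analysis.

Set Implicit Arguments.
Unset Strict Implicit.
Unset Printing Implicit Defensive.

Import Order.TTheory GRing.Theory Num.Theory numFieldNormedType.Exports.

Local Open Scope classical_set_scope.
Local Open Scope ring_scope.

(* A 3-dimensional Lie group with a left-invariant Riemannian metric and an
   orthonormal frame e_0, e_1, e_2 of left-invariant vector fields:
   - the group is the subspace [carrier] of an ambient space [ambient];
   - [flow i t] is the flow g |-> g * exp(t e_i) of e_i at time t; its values
     outside [carrier] are irrelevant;
   - [e_i, e_j] = \sum_k sconst i j k e_k. *)
Record framed_group (R : realType) := FramedGroup {
  ambient : topologicalType;
  carrier : set ambient;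
  flow : 'I_3 -> R -> ambient -> ambient;
  sconst : 'I_3 -> 'I_3 -> 'I_3 -> R
}.
Arguments carrier {R} M : rename.
Arguments flow {R} M : rename.
Arguments sconst {R} M : rename.

Section HodgeLaplacian.
Variables (R : realType) (M : framed_group R).

(* The frame trivializes the tangent bundle, so a p-form w is given by its
   components w(e_i1, ..., e_ip); only the values on [carrier M] matter. *)
Definition form0 := ambient M -> R.
Definition form1 := 'I_3 -> form0.
Definition form2 := 'I_3 -> 'I_3 -> form0.
Definition form3 := 'I_3 -> 'I_3 -> 'I_3 -> form0.

(* e_i f *)
Definition fder (i : 'I_3) (f : form0) : form0 :=
  fun g => derive1 (fun t : R => f (flow M i t g)) 0.

(* The e_i span every tangent space, so f is C^k iff its iterated derivatives
   along the e_i up to order k exist and are continuous. *)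
Fixpoint Ck (k : nat) (f : form0) : Prop :=
  {within carrier M, continuous f} /\
  if k is k'.+1 then
    (forall i g, carrier M g ->
       derivable (fun t : R => f (flow M i t g)) 0 1) /\
    (forall i, Ck k' (fder i f))
  else True.

Definition smooth (f : form0) := forall k, Ck k f.

(* Cartan's formulas for the exterior derivative, on the frame:
   dw(X,Y) = X w(Y) - Y w(X) - w([X,Y]), and the cyclic sum of
   X h(Y,Z) - h([X,Y],Z) for a 2-form h. *)
Definition d0 (f : form0) : form1 := fun i => fder i f.

Definition d1 (w : form1) : form2 := fun i j g =>
  fder i (w j) g - fder j (w i) g - \sum_k sconst M i j k * w k g.

Definition d2 (h : form2) : form3 := fun i j k g =>
  let cyc (x y z : 'I_3) :=
    fder x (h y z) g - \sum_l sconst M x y l * h l z g in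
  cyc i j k + cyc j k i + cyc k i j.

(* Levi-Civita symbol *)
Definition eps (i j k : 'I_3) : R :=
  (j%:R - i%:R) * (k%:R - i%:R) * (k%:R - j%:R) / 2.

(* Hodge stars of degree 1, 2, 3; the frame is orthonormal and is declared to
   be positively oriented. *)
Definition star1 (w : form1) : form2 := fun i j g =>
  \sum_k eps i j k * w k g.

Definition star2 (h : form2) : form1 := fun k g =>
  2^-1 * \sum_i \sum_j eps i j k * h i j g.

Definition star3 (v : form3) : form0 := v 0 1 2%:R.

(* In dimension n, delta = (-1)^(n (p + 1) + 1) * d * on p-forms; here n = 3. *)
Definition delta1 (w : form1) : form0 := fun g => - star3 (d2 (star1 w)) g.

Definition delta2 (h : form2) : form1 := star2 (d1 (star2 h)).

Definition hodge_laplacian1 (w : form1) : form1 := fun i g =>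
  d0 (delta1 w) i g + delta2 (d1 w) i g.

Definition hodge_eigenvalue1 (l : R) : Prop :=
  exists w : form1,
    [/\ forall i, smooth (w i),
        exists i g, carrier M g /\ w i g != 0
      & forall i g, carrier M g -> hodge_laplacian1 w i g = l * w i g].

Definition is_lambda1 (l : R) : Prop :=
  [/\ hodge_eigenvalue1 l, l != 0
    & forall m, hodge_eigenvalue1 m -> m != 0 -> l <= m].

End HodgeLaplacian.

Section Groups.
Variable R : realType.

Definition E (i : 'I_3) : 'M[R[i]]_2 :=
  \matrix_(r, s) nth 0 (nth [::] (nth [::]
    [:: [:: [:: 'i%C; 0];
            [:: 0; - 'i%C]];
        [:: [:: 0; 1];
            [:: -1; 0]];
        [:: [:: 0; 'i%C];
            [:: 'i%C; 0]]] i) r) s.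

(* The i-th coordinate of X in su(2) with respect to the basis E, since
   tr (E_i E_j) = -2 if i = j and 0 otherwise. *)
Definition coordE (i : 'I_3) (X : 'M[R[i]]_2) : R :=
  complex.Re (- \tr (E i *m X) / 2).

(* exp(t E_i), as E_i^2 = -1 *)
Definition expE (i : 'I_3) (t : R) : 'M[R[i]]_2 :=
  ((cos t)%:C%C)%:M + (sin t)%:C%C *: E i.

(* The adjoint representation SU(2) -> SO(3), in the basis E; it induces the
   isomorphism SU(2)/{1,-1} = SO(3). *)
Definition Ad (u : 'M[R[i]]_2) : 'M[R]_3 :=
  \matrix_(i, j) coordE i (u *m E j *m invmx u).

Variables a b c : R.

Definition abc (i : 'I_3) : R := nth 0 [:: a; b; c] i.

(* the orthonormal basis a E_1, b E_2, c E_3 *)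
Definition frame (i : 'I_3) : 'M[R[i]]_2 := (abc i)%:C%C *: E i.

Definition frame_sconst (i j k : 'I_3) : R :=
  coordE k (frame i *m frame j - frame j *m frame i) / abc k.

Definition SU2 : framed_group R :=
  @FramedGroup R 'M[R[i] : numFieldType]_2
    [set u : 'M[R[i]]_2 | u \is unitarymx /\ \det u = 1]
    (fun i t u => u *m expE i (abc i * t))
    frame_sconst.

(* [Ad] maps the frame of SU(2) to that of SO(3). *)
Definition SO3 : framed_group R :=
  @FramedGroup R 'M[R]_3
    [set A : 'M[R]_3 | A *m A^T = 1%:M /\ \det A = 1]
    (fun i t A => A *m Ad (expE i (abc i * t)))
    frame_sconst.

End Groups.

(* Main.v *)
Require Import Defs.
From HB Require Import structures.
From mathcomp Require Import all_boot all_order all_algebra.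
From mathcomp Require Import complex.
From mathcomp Require Import all_classical all_reals all_analysis.
From mathcomp Require Import ring lra.

(* Pull an eigenform of either group back to the unit quaternions by a left
   translate of the covering map.  Convolving its components with (h . x) ^ n
   commutes with the left-invariant fields E_i; for the least n giving a nonzero
   result w, the latter is an eigenform for the same eigenvalue l, of the parity
   of n, and -(E_1^2 + E_2^2 + E_3^2) acts on it as the scalar n (n + 2).
   If div w is nonzero, it is an eigenfunction for l of the Laplacian on
   functions: for n odd -E_i^2 >= 1, so l >= a^2 + b^2 + c^2, and for n even the
   scalar n (n + 2) is at least 8, which is more than enough.  Otherwise w may
   be taken to be an eigenform of D := star d.  As d does not see the metric, a
   rescaling of the components yields N v = q v, with N the operator D of the
   round metric and q diagonal with entries sqrt l * a / (b * c) and so on, up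
   to a common sign.  The nonzero spectrum of N has absolute value at least 2,
   hence |N v|^2 >= 2 |<N v, v>|, so some entry of q has absolute value at least
   2.  Von Neumann's mean plays the role of the Haar integral. *)

Set Implicit Arguments.
Unset Strict Implicit.
Unset Printing Implicit Defensive.

Import Order.TTheory GRing.Theory Num.Theory numFieldNormedType.Exports.
Local Open Scope classical_set_scope.
Local Open Scope ring_scope.

(** * Representations of su(2) *)

(** The power [(h . x) ^ n] is not a spherical harmonic: with s = h . x, the sum of the squares of
    the E_i sends s^n to n (n - 1) s^(n - 2) - n (n + 2) s^n. The first term contributes a
    convolution with s^(n - 2), and it is the minimality of n that removes it. This replaces a
    decomposition into irreducible representations: a single nonzero component carries the
    eigenvalue l, so it suffices to study that one. The argument lives in a module with a definite
    form for which the fields are skew. Skewness comes from the invariance of the mean, definiteness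
    from the concentration of the kernels (s^(2n) + s^(2n+1)) near s = 1. The two groups differ
    because a^2 + b^2 + c^2 arises only from odd n, while a form lifted from SO(3) takes equal
    values at antipodal quaternions, which forces n to be even. The other three values are attained
    by the left-invariant coframe, on both groups. *)

Section Su2Module.
Variables (R : rcfType) (V : lmodType R) (X Y Z : {linear V -> V}).
Variables (B : V -> V -> R) (n : nat).
Hypothesis BD : forall f g h, B (f + g) h = B f h + B g h.
Hypothesis BZ : forall k f h, B (k *: f) h = k * B f h.
Hypothesis Bsym : forall f g, B f g = B g f.
Hypothesis B_ge0 : forall f, 0 <= B f f.
Hypothesis B_eq0 : forall f, B f f = 0 -> f = 0.
Hypothesis skewX : forall f g, B (X f) g = - B f (X g).
Hypothesis skewY : forall f g, B (Y f) g = - B f (Y g).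
Hypothesis skewZ : forall f g, B (Z f) g = - B f (Z g).
Hypothesis YX : forall f, Y (X f) = X (Y f) - 2 *: Z f.
Hypothesis ZX : forall f, Z (X f) = X (Z f) + 2 *: Y f.
Hypothesis ZY : forall f, Z (Y f) = Y (Z f) - 2 *: X f.
Let kap : R := n%:R * (n%:R + 2).
Hypothesis casimir : forall f, Z (Z f) = - kap *: f - X (X f) - Y (Y f).

Let BN f h : B (- f) h = - B f h.
Proof. by rewrite -scaleN1r BZ mulN1r. Qed.
Let BDr f g h : B h (f + g) = B h f + B h g.
Proof. by rewrite !(Bsym h) BD. Qed.
Let BZr k f h : B h (k *: f) = k * B h f.
Proof. by rewrite !(Bsym h) BZ. Qed.
Let BNr f h : B h (- f) = - B h f.
Proof. by rewrite !(Bsym h) BN. Qed.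
Let B0 h : B 0 h = 0.
Proof. by rewrite -(scale0r 0) BZ mul0r. Qed.

Let Blin := (BD, BN, BZ, BDr, BNr, BZr, B0).
Let opE := (linearD, linearN, linearZ).

(** Vector identities are tested against an arbitrary [h]; they become scalar identities, within
    reach of [ring], [field] and [lra]. *)
Lemma form_inj f g : (forall h, B f h = B g h) -> f = g.
Proof.
move=> fg; apply/eqP; rewrite -subr_eq0; apply/eqP/B_eq0.
by rewrite BD BN fg subrr.
Qed.

Lemma formN_le f g : B (f - g) (f - g) <= 2 * (B f f + B g g).
Proof. by have := B_ge0 (f + g); rewrite !Blin (Bsym g f); lra. Qed.

Lemma casimir_form f :
  B (X f) (X f) + B (Y f) (Y f) + B (Z f) (Z f) = kap * B f f.
Proof.
have := congr1 (B^~ f) (casimir f).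
by rewrite /= !Blin (skewX (X f)) (skewY (Y f)) (skewZ (Z f)); lra.
Qed.

(** The operator [star d] of the round metric in the frame X, Y, Z; the term -2 comes from the
    brackets [Y, Z] = 2 X and its cyclic analogues. *)
Local Notation c1 u1 u2 u3 := (Y u3 - Z u2 - 2 *: u1).
Local Notation c2 u1 u2 u3 := (Z u1 - X u3 - 2 *: u2).
Local Notation c3 u1 u2 u3 := (X u2 - Y u1 - 2 *: u3).

Lemma round_curl_sym u1 u2 u3 v1 v2 v3 :
  B (c1 u1 u2 u3) v1 + B (c2 u1 u2 u3) v2 + B (c3 u1 u2 u3) v3 =
  B u1 (c1 v1 v2 v3) + B u2 (c2 v1 v2 v3) + B u3 (c3 v1 v2 v3).
Proof. by rewrite !(Blin, skewX, skewY, skewZ); ring. Qed.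

Lemma round_div_curl u1 u2 u3 :
  X (c1 u1 u2 u3) + Y (c2 u1 u2 u3) + Z (c3 u1 u2 u3) = 0.
Proof.
apply: form_inj => h.
by rewrite !opE /= !(YX, ZX, ZY) !Blin; ring.
Qed.

(** Writing N for the round curl, this is (N - n) (N + n + 2) = 0 on divergence-free triples. Each
    component uses the derivative of the divergence along its own field to trade the mixed second
    derivatives for the Casimir relation. *)
Lemma round_curl_curl u1 u2 u3 : X u1 + Y u2 + Z u3 = 0 ->
  let p1 := c1 u1 u2 u3 in let p2 := c2 u1 u2 u3 in let p3 := c3 u1 u2 u3 in
  [/\ c1 p1 p2 p3 = kap *: u1 - 2 *: p1,
      c2 p1 p2 p3 = kap *: u2 - 2 *: p2
    & c3 p1 p2 p3 = kap *: u3 - 2 *: p3].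
Proof.
move=> div0 /=.
split; apply: form_inj => h.
- have := congr1 (fun f => B (X f) h) div0.
  rewrite !opE linear0 /= !(YX, ZX, ZY, casimir) !Blin => ?; lra.
- have := congr1 (fun f => B (Y f) h) div0.
  rewrite !opE linear0 /= !(YX, ZX, ZY, casimir) !Blin => ?; lra.
have := congr1 (fun f => B (Z f) h) div0.
rewrite !opE linear0 /= !(YX, ZX, ZY, casimir) !Blin => ?; lra.
Qed.


Hypothesis oddX : odd n -> forall f, B f f <= B (X f) (X f).
Hypothesis oddY : odd n -> forall f, B f f <= B (Y f) (Y f).
Hypothesis oddZ : odd n -> forall f, B f f <= B (Z f) (Z f).

Lemma casimir0_ker : n = 0%N -> forall f, [/\ X f = 0, Y f = 0 & Z f = 0].
Proof.
move=> n0 f; have := casimir_form f; rewrite /kap n0 mul0r mul0r.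
have := B_ge0 (X f); have := B_ge0 (Y f); have := B_ge0 (Z f).
by move=> ? ? ? ?; split; apply: B_eq0; lra.
Qed.

(* In the doublet all three fields are isometric, so the curl is too small in
   norm to have a fixed vector after the shift by 2. *)
Lemma doublet_curl_fixed u1 u2 u3 : n = 1%N ->
  c1 u1 u2 u3 = u1 -> c2 u1 u2 u3 = u2 -> c3 u1 u2 u3 = u3 ->
  [/\ u1 = 0, u2 = 0 & u3 = 0].
Proof.
move=> n1 e1 e2 e3.
have isom f : [/\ B (X f) (X f) = B f f, B (Y f) (Y f) = B f f
    & B (Z f) (Z f) = B f f].
  have := casimir_form f; rewrite /kap n1.
  have := oddX (etrans (congr1 odd n1) erefl) f.
  have := oddY (etrans (congr1 odd n1) erefl) f.
  have := oddZ (etrans (congr1 odd n1) erefl) f.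
  by move=> ? ? ? ?; split; lra.
have h (f g u : V) : f - g - 2 *: u = u -> 9 * B u u <= 2 * (B f f + B g g).
  move=> fgu; have -> : 9 * B u u = B (f - g) (f - g).
    have -> : f - g = 3 *: u.
      by apply: form_inj => k; have := congr1 (B^~ k) fgu; rewrite /= !Blin;
        lra.
    by rewrite !Blin; ring.
  exact: formN_le.
have := h _ _ _ e1; have := h _ _ _ e2; have := h _ _ _ e3.
have [X1 Y1 Z1] := isom u1; have [X2 Y2 Z2] := isom u2.
have [X3 Y3 Z3] := isom u3; rewrite X2 X3 Y1 Y3 Z1 Z2.
have := B_ge0 u1; have := B_ge0 u2; have := B_ge0 u3.
by move=> ? ? ? ? ? ?; split; apply: B_eq0; lra.
Qed.

Lemma round_curl_lin (F G : {linear V -> V}) k f f' g g' h h' :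
  F (f + k *: f') - G (g + k *: g') - 2 *: (h + k *: h') =
  (F f - G g - 2 *: h) + k *: (F f' - G g' - 2 *: h').
Proof. by apply: form_inj => w; rewrite !opE /= !Blin; ring. Qed.

(** The triple [v] may have a divergence but N v has none, so N has only the eigenvalues n and -(n +
    2) on its image. Both are at least 2 in absolute value for n >= 2; for n = 0 the fields vanish
    and N = -2; for n = 1 the eigenvalue 1 has to be excluded. *)
Lemma round_curl_gap v1 v2 v3 :
  let p1 := c1 v1 v2 v3 in let p2 := c2 v1 v2 v3 in let p3 := c3 v1 v2 v3 in
  `|2 * (B p1 v1 + B p2 v2 + B p3 v3)| <= B p1 p1 + B p2 p2 + B p3 p3.
Proof.
case: (posnP n) => [n0|n_gt0].
  have k0 f := casimir0_ker n0 f.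
  have [X1 Y1 Z1] := k0 v1; have [X2 Y2 Z2] := k0 v2; have [X3 Y3 Z3] := k0 v3.
  rewrite /= X2 X3 Y1 Y3 Z1 Z2 !Blin.
  have := B_ge0 v1; have := B_ge0 v2; have := B_ge0 v3.
  by move=> ? ? ?; rewrite ler_norml; apply/andP; split; lra.
have p_div := round_div_curl v1 v2 v3.
have := round_curl_curl p_div.
have v_sym := round_curl_sym v1 v2 v3.
set p1 := c1 v1 v2 v3; set p2 := c2 v1 v2 v3; set p3 := c3 v1 v2 v3.
set r1 := c1 p1 p2 p3; set r2 := c2 p1 p2 p3; set r3 := c3 p1 p2 p3.
move=> /= [rr1 rr2 rr3].
have rp_v := round_curl_sym p1 p2 p3 v1 v2 v3.
have rr_p := round_curl_sym r1 r2 r3 p1 p2 p3.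
have rr_v := round_curl_sym r1 r2 r3 v1 v2 v3.
rewrite -/p1 -/p2 -/p3 -/r1 -/r2 -/r3 in rp_v rr_p rr_v.
(* Since (N - 1) (N + 3) = 0 on N v, the triple r + 3 p = (N + 3) p is fixed by N, hence zero in the
   doublet. *)
have doublet : n = 1%N -> [/\ r1 + 3 *: p1 = 0, r2 + 3 *: p2 = 0
    & r3 + 3 *: p3 = 0].
  move=> n1; have kap3 : kap = 3 by rewrite /kap n1; ring.
  have fixed (c r p k : V) : k = kap *: p - 2 *: r -> c = k + 3 *: r ->
      c = r + 3 *: p.
    by move=> kE ->; rewrite kE kap3; apply: form_inj => h; rewrite !Blin; ring.
  apply: doublet_curl_fixed => //.
  - exact: fixed rr1 (round_curl_lin _ _ _ _ _ _ _ _ _).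
  - exact: fixed rr2 (round_curl_lin _ _ _ _ _ _ _ _ _).
  exact: fixed rr3 (round_curl_lin _ _ _ _ _ _ _ _ _).
rewrite rr1 rr2 rr3 in rr_p rr_v.
clearbody r1 r2 r3; clearbody p1 p2 p3.
rewrite !Blin in rr_p rr_v.
(* By symmetry of N, these are the moments <N^k v, v> for k = 1, ..., 4; they stand in for a
   diagonalization. *)
have [m1 m1E] : {m1 | m1 = B p1 v1 + B p2 v2 + B p3 v3} by eexists.
have [m2 m2E] : {m2 | m2 = B p1 p1 + B p2 p2 + B p3 p3} by eexists.
have [m3 m3E] : {m3 | m3 = B r1 p1 + B r2 p2 + B r3 p3} by eexists.
have [m4 m4E] : {m4 | m4 = B r1 r1 + B r2 r2 + B r3 r3} by eexists.
rewrite -m1E -m2E.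
have E1 : kap * m1 = m3 + 2 * m2 by rewrite m1E m2E m3E; lra.
have E2 : m4 = kap * m2 - 2 * m3 by rewrite m4E m2E m3E; lra.
have m2_ge0 : 0 <= m2.
  by rewrite m2E; have := B_ge0 p1; have := B_ge0 p2; have := B_ge0 p3; lra.
have sq (t : R) : 0 <= m4 + 2 * t * m3 + t ^+ 2 * m2.
  have := B_ge0 (r1 + t *: p1); have := B_ge0 (r2 + t *: p2).
  have := B_ge0 (r3 + t *: p3); rewrite !Blin (Bsym p1 r1) (Bsym p2 r2).
  by rewrite (Bsym p3 r3) m4E m3E m2E => ? ? ?; lra.
have n_ge1 : 1 <= n%:R :> R by rewrite ler1n.
(* In |(N + t) p|^2 the choice t = n + 2 leaves only the eigenvalue n, and t = - n leaves only -(n +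
   2). The factor 2 n + 2 is the distance between the two eigenvalues. *)
have m3_lo : 0 <= m3 + (n%:R + 2) * m2.
  rewrite -(@pmulr_rge0 _ (2 * n%:R + 2)); last by lra.
  by have := sq (n%:R + 2); rewrite E2 /kap; nra.
have m3_hi : m3 <= n%:R * m2.
  rewrite -subr_ge0 -(@pmulr_rge0 _ (2 * n%:R + 2)); last by lra.
  by have := sq (- n%:R); rewrite E2 /kap; nra.
have kap_gt0 : 0 < kap by rewrite /kap; nra.
case: (leqP 2 n) => [n_ge2|n_le1].
  have n2 : 2 <= n%:R :> R by rewrite (ler_nat R 2).
  rewrite ler_norml; apply/andP; split; rewrite -(ler_pM2l kap_gt0).
    by rewrite /kap in E1 *; nra.
  by rewrite /kap in E1 *; nra.
have n1 : n = 1%N by apply/eqP; rewrite eqn_leq n_gt0 -ltnS n_le1.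
have kap3 : kap = 3 by rewrite /kap n1; ring.
have [y1 y2 y3] := doublet n1.
have := congr1 (B^~ p1) y1; have := congr1 (B^~ p2) y2.
have := congr1 (B^~ p3) y3; rewrite /= !Blin => z3 z2 z1.
rewrite kap3 in E1.
have E3 : m3 = - 3 * m2 by rewrite m3E m2E; lra.
by rewrite ler_norml; apply/andP; split; lra.
Qed.


Variables (a b c : R).
Hypotheses (a_gt0 : 0 < a) (b_gt0 : 0 < b) (c_gt0 : 0 < c).

Local Notation n1 u1 u2 u3 := (b *: Y u3 - c *: Z u2 - (2 * b * c / a) *: u1).
Local Notation n2 u1 u2 u3 := (c *: Z u1 - a *: X u3 - (2 * a * c / b) *: u2).
Local Notation n3 u1 u2 u3 := (a *: X u2 - b *: Y u1 - (2 * a * b / c) *: u3).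
Local Notation div u1 u2 u3 := (a *: X u1 + b *: Y u2 + c *: Z u3).
Let ale l := 4 * b ^+ 2 * c ^+ 2 / a ^+ 2 <= l.
Let ble l := 4 * a ^+ 2 * c ^+ 2 / b ^+ 2 <= l.
Let cle l := 4 * a ^+ 2 * b ^+ 2 / c ^+ 2 <= l.

Lemma weight_gap (x y z nu : R) : 0 < x -> 0 < y -> 0 < z ->
  nu ^+ 2 < 4 * x ^+ 2 * y ^+ 2 / z ^+ 2 -> `|nu * z / (x * y)| < 2.
Proof.
move=> x0 y0 z0 h; rewrite -(ltr_pXn2r (n := 2)) ?nnegrE //.
rewrite real_normK ?num_real // !(exprMn, exprVn).
rewrite ltr_pdivrMr; last by rewrite mulr_gt0 ?exprn_gt0.
by move: h; rewrite ltr_pdivlMr ?exprn_gt0 //; lra.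
Qed.

(* Rescaling the components by the frame lengths turns the eigenvalue equation
   of star d for the metric into [round_curl v = q v] with diagonal weights q of
   constant sign, since the exterior derivative does not see the metric. *)
Lemma curl_eigenvalue_bound u1 u2 u3 nu : nu != 0 ->
  n1 u1 u2 u3 = nu *: u1 -> n2 u1 u2 u3 = nu *: u2 -> n3 u1 u2 u3 = nu *: u3 ->
  ~ [/\ u1 = 0, u2 = 0 & u3 = 0] ->
  [\/ ale (nu ^+ 2), ble (nu ^+ 2) | cle (nu ^+ 2)].
Proof.
move=> nu0 e1 e2 e3 u0.
have a0 : a != 0 by rewrite gt_eqF.
have b0 : b != 0 by rewrite gt_eqF.
have c0 : c != 0 by rewrite gt_eqF.
have [?|a_lt] := leP (4 * b ^+ 2 * c ^+ 2 / a ^+ 2) (nu ^+ 2).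
  by constructor 1.
have [?|b_lt] := leP (4 * a ^+ 2 * c ^+ 2 / b ^+ 2) (nu ^+ 2).
  by constructor 2.
have [?|c_lt] := leP (4 * a ^+ 2 * b ^+ 2 / c ^+ 2) (nu ^+ 2).
  by constructor 3.
exfalso; apply: u0.
have [q1 q1E] : {q | q = nu * a / (b * c)} by eexists.
have [q2 q2E] : {q | q = nu * b / (a * c)} by eexists.
have [q3 q3E] : {q | q = nu * c / (a * b)} by eexists.
have := weight_gap b_gt0 c_gt0 a_gt0 a_lt.
have := weight_gap a_gt0 c_gt0 b_gt0 b_lt.
have := weight_gap a_gt0 b_gt0 c_gt0 c_lt.
rewrite -q1E -q2E -q3E => q3_lt q2_lt q1_lt.
have r1 : c1 (a^-1 *: u1) (b^-1 *: u2) (c^-1 *: u3) = q1 *: (a^-1 *: u1).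
  apply: form_inj => h; have := congr1 (B^~ h) e1;
    rewrite !opE /= !Blin q1E => e.
  have -> : a^-1 * (nu * a / (b * c) * B u1 h) = (b * c)^-1 * (nu * B u1 h)
    by field; rewrite ?a0 ?b0 ?c0.
  by rewrite -e; field; rewrite ?a0 ?b0 ?c0.
have r2 : c2 (a^-1 *: u1) (b^-1 *: u2) (c^-1 *: u3) = q2 *: (b^-1 *: u2).
  apply: form_inj => h; have := congr1 (B^~ h) e2;
    rewrite !opE /= !Blin q2E => e.
  have -> : b^-1 * (nu * b / (a * c) * B u2 h) = (a * c)^-1 * (nu * B u2 h)
    by field; rewrite ?a0 ?b0 ?c0.
  by rewrite -e; field; rewrite ?a0 ?b0 ?c0.
have r3 : c3 (a^-1 *: u1) (b^-1 *: u2) (c^-1 *: u3) = q3 *: (c^-1 *: u3).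
  apply: form_inj => h; have := congr1 (B^~ h) e3;
    rewrite !opE /= !Blin q3E => e.
  have -> : c^-1 * (nu * c / (a * b) * B u3 h) = (a * b)^-1 * (nu * B u3 h)
    by field; rewrite ?a0 ?b0 ?c0.
  by rewrite -e; field; rewrite ?a0 ?b0 ?c0.
have := round_curl_gap (a^-1 *: u1) (b^-1 *: u2) (c^-1 *: u3).
rewrite /= r1 r2 r3 !Blin.
have U1 := B_ge0 u1; have U2 := B_ge0 u2; have U3 := B_ge0 u3.
have [b1 b1E] : {x | x = B u1 u1} by eexists.
have [b2 b2E] : {x | x = B u2 u2} by eexists.
have [b3 b3E] : {x | x = B u3 u3} by eexists.
rewrite -b1E -b2E -b3E => gap.
have ia : 0 < a^-1 ^+ 2 * `|q1| * (2 - `|q1|).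
  rewrite !mulr_gt0 ?exprn_gt0 ?invr_gt0 ?subr_gt0 // normr_gt0 q1E.
  by rewrite !mulf_neq0 // invr_eq0 mulf_neq0.
have ib : 0 < b^-1 ^+ 2 * `|q2| * (2 - `|q2|).
  rewrite !mulr_gt0 ?exprn_gt0 ?invr_gt0 ?subr_gt0 // normr_gt0 q2E.
  by rewrite !mulf_neq0 // invr_eq0 mulf_neq0.
have ic : 0 < c^-1 ^+ 2 * `|q3| * (2 - `|q3|).
  rewrite !mulr_gt0 ?exprn_gt0 ?invr_gt0 ?subr_gt0 // normr_gt0 q3E.
  by rewrite !mulf_neq0 // invr_eq0 mulf_neq0.
(* All weights have the sign of [nu], so with v the rescaled triple the gap reads 2 sum |q_i|
   |v_i|^2 <= sum q_i^2 |v_i|^2. *)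
have sum_le0 : a^-1 ^+ 2 * `|q1| * (2 - `|q1|) * b1 +
    b^-1 ^+ 2 * `|q2| * (2 - `|q2|) * b2 + c^-1 ^+ 2 * `|q3| * (2 - `|q3|) * b3
    <= 0.
  have q_gt0 (x y z : R) : 0 < x -> 0 < y -> 0 < z -> 0 < nu -> 0 < nu * z / (x
    * y).
    by move=> ? ? ? ?; rewrite !mulr_gt0 // invr_gt0 mulr_gt0.
  have q_lt0 (x y z : R) : 0 < x -> 0 < y -> 0 < z -> nu < 0 -> nu * z / (x *
    y) < 0.
    by move=> ? ? ? ?; rewrite nmulr_rlt0 ?invr_gt0 ?mulr_gt0 // nmulr_rlt0.
  move: gap; rewrite ler_norml => /andP[gap1 gap2].
  case: (ltrgtP nu 0) nu0 => // [nu_lt|nu_gt] _.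
    by rewrite !ltr0_norm ?q1E ?q2E ?q3E ?q_lt0 // -q1E -q2E -q3E; lra.
  by rewrite !gtr0_norm ?q1E ?q2E ?q3E ?q_gt0 // -q1E -q2E -q3E; lra.
have bz1 := mulr_ge0 (ltW ia) U1; have bz2 := mulr_ge0 (ltW ib) U2.
have bz3 := mulr_ge0 (ltW ic) U3; rewrite -b1E in bz1; rewrite -b2E in bz2.
rewrite -b3E in bz3.
have kill k x : 0 < k -> k * x = 0 -> x = 0.
  by move=> k0 /eqP; rewrite mulf_eq0 gt_eqF //= => /eqP.
split; apply: B_eq0.
- by rewrite -b1E; apply: kill ia _; lra.
- by rewrite -b2E; apply: kill ib _; lra.
by rewrite -b3E; apply: kill ic _; lra.
Qed.

(** For even n > 0, suppose l is below all three values. Multiplying two of these bounds gives l^2 <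
    16 c^4 and the like, so l is below 4 a^2, 4 b^2 and 4 c^2. Weighting the Casimir relation by l
    then yields kap l <= 4 l, against kap >= 8. For n = 0 the fields vanish and l would be 0. *)
Lemma function_eigenvalue_bound f l : f != 0 -> l != 0 ->
  a ^+ 2 *: X (X f) + b ^+ 2 *: Y (Y f) + c ^+ 2 *: Z (Z f) = - l *: f ->
  [\/ ale l, ble l | cle l] \/ (odd n /\ a ^+ 2 + b ^+ 2 + c ^+ 2 <= l).
Proof.
move=> f0 l0 lapl.
have b0 : 0 < B f f.
  by rewrite lt_neqAle B_ge0 andbT eq_sym; apply: contra_neq f0 => /B_eq0.
have E : a ^+ 2 * B (X f) (X f) + b ^+ 2 * B (Y f) (Y f) +
    c ^+ 2 * B (Z f) (Z f) = l * B f f.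
  have := congr1 (B^~ f) lapl.
  by rewrite /= !Blin (skewX (X f)) (skewY (Y f)) (skewZ (Z f)); lra.
have cas := casimir_form f.
have a2 : 0 < a ^+ 2 by rewrite exprn_gt0.
have b2 : 0 < b ^+ 2 by rewrite exprn_gt0.
have c2 : 0 < c ^+ 2 by rewrite exprn_gt0.
have [n_odd|n_even] := boolP (odd n).
  right; split => //; rewrite -(ler_pM2r b0) -E !mulrDl.
  by rewrite !lerD // ler_pM2l // ?oddX ?oddY ?oddZ.
left; case: (posnP n) => [n0|n_gt0].
  have [X0 Y0 Z0] := casimir0_ker n0 f; move: E;
    rewrite X0 Y0 Z0 !Blin => /esym/eqP.
  by rewrite !mulr0 !addr0 mulf_eq0 (negbTE l0) gt_eqF.
have n_ge2 : 2 <= n%:R :> R.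
  by rewrite (ler_nat R 2); case: (n) n_even n_gt0 => [|[]].
have kap8 : 8 <= kap by rewrite /kap; nra.
have [?|a_lt] := leP (4 * b ^+ 2 * c ^+ 2 / a ^+ 2) l; first by constructor 1.
have [?|b_lt] := leP (4 * a ^+ 2 * c ^+ 2 / b ^+ 2) l; first by constructor 2.
have [?|c_lt] := leP (4 * a ^+ 2 * b ^+ 2 / c ^+ 2) l; first by constructor 3.
exfalso.
have l_ge0 : 0 <= l.
  rewrite -(pmulr_lge0 l b0) -E !addr_ge0 // mulr_ge0 ?B_ge0 // ltW //.
have small (x y z : R) : 0 < x -> 0 < y -> 0 < z -> l < 4 * y * z / x ->
    l < 4 * x * z / y -> l < 4 * z.
  move=> x0 y0 z0 h1 h2; rewrite -(ltr_pXn2r (n := 2)) ?nnegrE //; last by lra.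
  have -> : (4 * z) ^+ 2 = (4 * y * z / x) * (4 * x * z / y).
    by field; rewrite !gt_eqF.
  by rewrite expr2; apply: ltr_pM.
have la : l < 4 * a ^+ 2.
  apply: (small _ _ _ b2 c2 a2).
  - by move: b_lt; congr (_ < _); ring.
  - by move: c_lt; congr (_ < _); ring.
have lb : l < 4 * b ^+ 2.
  apply: (small _ _ _ a2 c2 b2).
  - by move: a_lt; congr (_ < _); ring.
  - by move: c_lt; congr (_ < _); ring.
have lc : l < 4 * c ^+ 2.
  apply: (small _ _ _ a2 b2 c2).
  - by move: a_lt; congr (_ < _); ring.
  - by move: b_lt; congr (_ < _); ring.
have := B_ge0 (X f); have := B_ge0 (Y f); have := B_ge0 (Z f).
move: cas E; move: (B (X f) (X f)) (B (Y f) (Y f)) (B (Z f) (Z f)) => x y z.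
move=> cas E z0 y0 x0.
have : l * (kap * B f f) <= 4 * (l * B f f).
  by rewrite -E -cas; have := ler_wpM2r x0 (ltW la);
    have := ler_wpM2r y0 (ltW lb); have := ler_wpM2r z0 (ltW lc); lra.
have l_gt0 : 0 < l by rewrite lt_neqAle eq_sym l0.
by have := mulr_gt0 l_gt0 b0; nra.
Qed.

Lemma div_curl u1 u2 u3 :
  div (n1 u1 u2 u3) (n2 u1 u2 u3) (n3 u1 u2 u3) = 0.
Proof.
apply: form_inj => h; rewrite !opE /= !(YX, ZX, ZY) !Blin; field.
by rewrite !gt_eqF.
Qed.

Lemma curl_lin (F G : {linear V -> V}) (x y z k : R) f f' g g' h h' :
  x *: F (f + k *: f') - y *: G (g + k *: g') - z *: (h + k *: h') =
  (x *: F f - y *: G g - z *: h) + k *: (x *: F f' - y *: G g' - z *: h').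
Proof. by apply: form_inj => w; rewrite !opE /= !Blin; ring. Qed.

Lemma curl_sym u1 u2 u3 v1 v2 v3 :
  B (n1 u1 u2 u3) v1 + B (n2 u1 u2 u3) v2 + B (n3 u1 u2 u3) v3 =
  B u1 (n1 v1 v2 v3) + B u2 (n2 v1 v2 v3) + B u3 (n3 v1 v2 v3).
Proof. by rewrite !(Blin, skewX, skewY, skewZ); ring. Qed.


(** The divergence of the system kills the double curl and leaves the Laplace equation for d. If d =
    0, the curl squares to l on u, and curl + sqrt l sends u to an eigenvector for sqrt l, unless it
    kills u, which is then an eigenvector for - sqrt l. *)
Lemma hodge_eigenvalue_bound u1 u2 u3 l :
  let p1 := n1 u1 u2 u3 in let p2 := n2 u1 u2 u3 in let p3 := n3 u1 u2 u3 in
  let d := div u1 u2 u3 in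
  l != 0 -> ~ [/\ u1 = 0, u2 = 0 & u3 = 0] ->
  n1 p1 p2 p3 - a *: X d = l *: u1 ->
  n2 p1 p2 p3 - b *: Y d = l *: u2 ->
  n3 p1 p2 p3 - c *: Z d = l *: u3 ->
  [\/ ale l, ble l | cle l] \/ (odd n /\ a ^+ 2 + b ^+ 2 + c ^+ 2 <= l).
Proof.
move=> p1 p2 p3 d l0 u0 e1 e2 e3.
have [d0|d_neq0] := eqVneq d 0; last first.
  apply: (function_eigenvalue_bound d_neq0 l0); apply: form_inj => h.
  have := congr1 (B^~ h) (div_curl p1 p2 p3).
  have /(congr1 (fun f => B (a *: X f) h)) := e1.
  have /(congr1 (fun f => B (b *: Y f) h)) := e2.
  have /(congr1 (fun f => B (c *: Z f) h)) := e3.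
  have -> : B (- l *: d) h = - l * (a * B (X u1) h + b * B (Y u2) h + c * B (Z
    u3) h).
    by rewrite /d !Blin; ring.
  set k1 := n1 p1 p2 p3; set k2 := n2 p1 p2 p3; set k3 := n3 p1 p2 p3.
  by clearbody k1 k2 k3 d; rewrite !opE /= !Blin => ? ? ? ?; lra.
have [q1 q2 q3] : [/\ n1 p1 p2 p3 = l *: u1, n2 p1 p2 p3 = l *: u2
    & n3 p1 p2 p3 = l *: u3].
  by rewrite -e1 -e2 -e3 d0 !(linear0, scaler0, oppr0, addr0).
have sym := curl_sym p1 p2 p3 u1 u2 u3.
rewrite -/p1 -/p2 -/p3 q1 q2 q3 !BZ in sym.
have U1 := B_ge0 u1; have U2 := B_ge0 u2; have U3 := B_ge0 u3.
have U0 : 0 < B u1 u1 + B u2 u2 + B u3 u3.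
  rewrite lt_neqAle !addr_ge0 // andbT eq_sym; apply/eqP => U0; apply: u0.
  by split; apply: B_eq0; lra.
(* By symmetry of the curl, l |u|^2 = |curl u|^2, so l has a nonzero real square root. *)
have l_gt0 : 0 < l.
  rewrite lt_neqAle eq_sym l0 -(pmulr_lge0 l U0) !mulrDr sym.
  by rewrite !addr_ge0.
have muE := sqr_sqrtr (ltW l_gt0); set mu := Num.sqrt l in muE.
have mu0 : mu != 0 by rewrite gt_eqF // sqrtr_gt0.
have scale (r p v : V) : r = l *: v -> r + mu *: p = mu *: (p + mu *: v).
  by move=> ->; rewrite -muE scalerDr scalerA -expr2 addrC.
have y_eig : [/\ n1 (p1 + mu *: u1) (p2 + mu *: u2) (p3 + mu *: u3) =
      mu *: (p1 + mu *: u1),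
    n2 (p1 + mu *: u1) (p2 + mu *: u2) (p3 + mu *: u3) = mu *: (p2 + mu *: u2)
  & n3 (p1 + mu *: u1) (p2 + mu *: u2) (p3 + mu *: u3) = mu *: (p3 + mu *: u3)].
  by split; rewrite curl_lin; apply: scale.
have u_eig : [/\ p1 + mu *: u1 = 0, p2 + mu *: u2 = 0 & p3 + mu *: u3 = 0] ->
    [/\ p1 = - mu *: u1, p2 = - mu *: u2 & p3 = - mu *: u3].
  by move=> [/eqP + /eqP + /eqP];
    rewrite !addr_eq0 -!scaleNr => /eqP ? /eqP ? /eqP.
rewrite -muE; case: y_eig => y1 y2 y3.
case: (boolP [&& p1 + mu *: u1 == 0, p2 + mu *: u2 == 0 & p3 + mu *: u3 == 0]).
  move=> /and3P[/eqP z1 /eqP z2 /eqP z3]; have [] := u_eig; first by split.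
  rewrite -sqrrN => v1 v2 v3; left.
  by apply: (curl_eigenvalue_bound _ v1 v2 v3) => //; rewrite oppr_eq0.
move=> /and3P y0; left.
apply: (curl_eigenvalue_bound mu0 y1 y2 y3) => -[z1 z2 z3]; apply: y0.
by rewrite z1 z2 z3 eqxx.
Qed.

End Su2Module.

(** * Invariant mean *)

Section Average.
Variables (R : realType) (T : Type).
Implicit Types (s : seq T) (F : T -> R).

Definition avg s F : R := (\sum_(h <- s) F h) / (size s)%:R.

Lemma avgD s F F' : avg s (fun h => F h + F' h) = avg s F + avg s F'.
Proof. by rewrite /avg big_split mulrDl. Qed.

Lemma avgZ s k F : avg s (fun h => k * F h) = k * avg s F.
Proof. by rewrite /avg -mulr_sumr mulrA. Qed.

Lemma avg_cst s k : (0 < size s)%N -> avg s (fun=> k) = k.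
Proof.
move=> s0; rewrite /avg big_const_seq count_predT iter_addr_0.
by rewrite -[k *+ _]mulr_natr mulfK // pnatr_eq0 -lt0n.
Qed.

Lemma ler_avg s F F' : (forall h, F h <= F' h) -> avg s F <= avg s F'.
Proof.
by move=> FF; rewrite /avg ler_wpM2r ?invr_ge0 ?ler0n //; apply: ler_sum.
Qed.

Lemma avg_near s F c e : (0 < size s)%N -> (forall h, `|F h - c| <= e) ->
  `|avg s F - c| <= e.
Proof.
move=> s0 Fc; rewrite ler_distl; apply/andP; split.
  by rewrite -(avg_cst (c - e) s0); apply: ler_avg => h; move: (Fc h);
    rewrite ler_distl => /andP[].
by rewrite -(avg_cst (c + e) s0); apply: ler_avg => h; move: (Fc h);
  rewrite ler_distl => /andP[].
Qed.

Lemma avg_near2 s F F' e : (0 < size s)%N -> (forall h, `|F h - F' h| <= e) ->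
  `|avg s F - avg s F'| <= e.
Proof.
move=> s0 FF'; have -> : avg s F - avg s F' = avg s (fun h => F h - F' h) - 0.
  by rewrite subr0 -(mulN1r (avg s F')) -avgZ -avgD; congr avg;
    apply/funext => h; rewrite mulN1r.
by apply: avg_near => // h; rewrite subr0.
Qed.
End Average.

Lemma avg_exchange (R : realType) (T T' : Type) (s : seq T) (r : seq T')
    (F : T -> T' -> R) :
  avg s (fun h => avg r (F h)) = avg r (fun k => avg s (F^~ k)).
Proof.
by rewrite /avg -!mulr_suml exchange_big mulrAC.
Qed.

Lemma avg_allpairs (R : realType) (T1 T2 T : Type) (s : seq T1) (r : seq T2)
    (f : T1 -> T2 -> T) (F : T -> R) :
  avg (allpairs f s r) F = avg s (fun h => avg r (fun k => F (f h k))).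
Proof.
by rewrite /avg big_allpairs_dep size_allpairs natrM invfM -!mulr_suml mulrAC
  mulrA.
Qed.

(** A single low value lowers the whole average by an amount that depends only on the length of the
    list; this drives [ravg_flat]. *)
Lemma avg_drop (R : realType) (T : eqType) (s : seq T) (F : T -> R) M e h0 :
  h0 \in s -> (forall h, F h <= M) -> F h0 <= M - e ->
  avg s F <= M - e / (size s)%:R.
Proof.
move=> hs FM Fh0.
have s0 : 0 < (size s)%:R :> R by rewrite ltr0n; case: (s) hs.
rewrite /avg ler_pdivrMr // mulrBl divfK ?gt_eqF //.
rewrite (big_rem h0) //=.
have := ler_sum (rem h0 s) (P := xpredT) (fun h _ => FM h).
rewrite big_const_seq count_predT iter_addr_0 size_rem // -[M *+ _]mulr_natr.
move=> le_rem; apply: (le_trans (lerD Fh0 le_rem)).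
have -> : (size s)%:R = (size s).-1%:R + 1 :> R.
  by rewrite natr1 prednK // -(ltr0n R).
lra.
Qed.

(** A bi-invariant measure of closeness on a totally bounded group. The instance below is half the
    squared chordal distance of the 3-sphere, for which the triangle inequality fails. *)
Record bimetric (R : realType) (G : groupType) (d : G -> G -> R) : Prop := {
  bimetricC : forall x y, d x y = d y x;
  bimetricL : forall k x y, d (k * x)%g (k * y)%g = d x y;
  bimetricR : forall k x y, d (x * k)%g (y * k)%g = d x y;
  bimetric_bounded : forall r, 0 < r ->
    exists s : seq G, forall g, exists2 h, h \in s & d g h < r }.

(* A mean in the sense of von Neumann: the constant that is a uniform limit of
   averages of right translates of f, and also of left translates. *)
Section InvariantMean.
Variables (R : realType) (G : groupType) (d : G -> G -> R).
Hypothesis dP : bimetric d.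
Let dC := bimetricC dP.
Let dL := bimetricL dP.
Let dR := bimetricR dP.
Let d_bounded := bimetric_bounded dP.
Implicit Types (f g : G -> R) (x y k h : G) (s : seq G).

Definition ucont f :=
  forall e, 0 < e -> exists2 r, 0 < r & forall x y, d x y < r -> `|f x - f y|
    <= e.

Definition ramean f c := forall e, 0 < e ->
  exists2 s, (0 < size s)%N & forall x, `|avg s (fun h => f (x * h)%g) - c| <=
    e.
Definition lamean f c := forall e, 0 < e ->
  exists2 s, (0 < size s)%N & forall x, `|avg s (fun h => f (h * x)%g) - c| <=
    e.

(** By [meanP] the default 0 is never taken on uniformly continuous functions. *)
Definition mean f : R := xget 0 [set c | ramean f c /\ lamean f c]%classic.

Lemma dV x y : d x^-1%g y^-1%g = d x y.
Proof. by rewrite -(dL x) -(dR y) mulgV mul1g mulgVK dC. Qed.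

Lemma ucont_inv f : ucont f -> ucont (fun x => f x^-1%g).
Proof.
by move=> fu e /fu[r r0 fr]; exists r => // x y xy; apply: fr; rewrite dV.
Qed.

Lemma ucont_bounded f : ucont f -> exists M, forall x, `|f x| <= M.
Proof.
move=> /(_ 1 ltr01)[r r0 fr]; have [s sG] := d_bounded r0.
exists (\sum_(h <- s) `|f h| + 1) => x; have [h hs xh] := sG x.
have -> : f x = f h + (f x - f h) by rewrite addrC subrK.
apply: (le_trans (ler_normD _ _)); apply: lerD; last exact: fr.
by rewrite (big_rem h) //= lerDl sumr_ge0.
Qed.

(** If every average oscillated by more than e, then averaging its translates over a finite net
    would lower its upper bound by the fixed amount [dlt]; repeating this contradicts the
    boundedness of f. *)
Lemma ravg_flat f e : ucont f -> 0 < e -> exists2 s, (0 < size s)%N &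
  forall x y, avg s (fun h => f (y * h)%g) - avg s (fun h => f (x * h)%g) <= e.
Proof.
move=> fu e0; have [M fM] := ucont_bounded fu.
have [r r0 fr] := fu _ (divr_gt0 e0 (@ltr0Sn R 1)).
have [s0 s0G] := d_bounded r0.
have s0_gt0 : (0 < size s0)%N by have [h] := s0G 1%g; case: (s0).
apply: contrapT => noflat.
pose dlt := e / 2 / (size s0)%:R.
have dlt_gt0 : 0 < dlt by rewrite !divr_gt0 // ltr0n.
have step (n : nat) : exists2 s, (0 < size s)%N &
    forall x, avg s (fun h => f (x * h)%g) <= M - n%:R * dlt.
  elim: n => [|n [s s_gt0 sM]].
    exists [:: 1%g] => // x;
      rewrite mul0r subr0 -[leRHS](@avg_cst R G [:: 1%g] M) //.
    by apply: ler_avg => h; apply: le_trans (fM _); apply: ler_norm.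
  have [x [y xy]] : exists x y,
      e < avg s (fun h => f (y * h)%g) - avg s (fun h => f (x * h)%g).
    apply: contrapT => H; apply: noflat; exists s => // x y.
    by rewrite leNgt; apply/negP => xy; apply: H; exists x, y.
  (* The average is low at x. For every z the net contains some k near z, and then z k^-1 x is near
     x, so one term of the outer average is low. *)
  exists (allpairs (fun k h => (k^-1 * x * h)%g) s0 s).
    by rewrite size_allpairs muln_gt0 s0_gt0.
  move=> z; rewrite avg_allpairs.
  have [k ks zk] := s0G z.
  rewrite -natr1 mulrDl mul1r opprD addrA.
  apply: (avg_drop ks) => [h|].
    by apply: le_trans (sM (z * (h^-1 * x))%g); apply: ler_avg => j;
      rewrite !mulgA.
  set A := avg s _.
  have : `|A - avg s (fun h => f (x * h)%g)| <= e / 2.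
    apply: avg_near2 => // h; apply: fr.
    by rewrite !mulgA dR -[X in d _ X]mul1g dR -(dR k) mulgVK mul1g.
  rewrite ler_distl => /andP[_ Ax]; apply: (le_trans Ax).
  by have := sM y; lra.
(* More than 2 M / dlt steps bring the upper bound from M below -M. *)
pose n := Num.truncn (2 * M / dlt).
have [s s_gt0 sM] := step n.+1.
have := sM 1%g; apply/negP; rewrite -ltNge.
have le_avg : - M <= avg s (fun h => f (1 * h)%g).
  rewrite -(avg_cst (- M) s_gt0); apply: ler_avg => h.
  by have := fM (1 * h)%g; rewrite ler_norml => /andP[].
apply: lt_le_trans le_avg.
have : 2 * M < n.+1%:R * dlt by rewrite -ltr_pdivrMr // truncnS_gt.
by lra.
Qed.

Lemma lavg_flat f e : ucont f -> 0 < e -> exists2 s, (0 < size s)%N &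
  forall x y, avg s (fun h => f (h * y)%g) - avg s (fun h => f (h * x)%g) <= e.
Proof.
move=> /ucont_inv fu e0; have [s s0 sf] := ravg_flat fu e0.
exists [seq h^-1%g | h <- s]; first by rewrite size_map.
move=> x y; have := sf x^-1%g y^-1%g; rewrite /avg size_map !big_map.
by congr (_ / _ - _ / _ <= _); apply: eq_bigr => h _; rewrite invgM invgK.
Qed.

(** The double average of f (k h) over both lists is close to c and to c'. *)
Lemma mean_unique f c c' : ramean f c -> lamean f c' -> c = c'.
Proof.
move=> fc fc'; apply/eqP; rewrite -subr_eq0 -normr_le0.
apply/ler_addgt0Pl => e e0; rewrite addr0.
have e2 : 0 < e / 2 by rewrite divr_gt0.
have [s s0 sc] := fc _ e2; have [r r0 rc'] := fc' _ e2.
pose a := avg r (fun k => avg s (fun h => f (k * h)%g)).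
have ac : `|a - c| <= e / 2 by apply: avg_near.
have ac' : `|a - c'| <= e / 2.
  by rewrite /a avg_exchange; apply: avg_near => // h; apply: rc'.
have -> : c - c' = (a - c') - (a - c) by lra.
by apply: (le_trans (ler_normB _ _)); lra.
Qed.

Lemma meanP f : ucont f -> ramean f (mean f) /\ lamean f (mean f).
Proof.
move=> fu; apply: (@xgetPex _ 0 [set c | ramean f c /\ lamean f c]%classic) =>
  /=.
have flat_near (A : G -> R) e : (forall x y, A y - A x <= e) ->
    forall x y, `|A y - A x| <= e.
  move=> Ae x y; rewrite ler_norml Ae andbT.
  by have := Ae y x; lra.
(* Lower estimates of the limit: a right average minus a bound on its oscillation. Left averages
   bound them from above, by [cross], and the supremum is the constant sought. *)
pose P := [set c | exists e s, [/\ 0 < e, (0 < size s)%N,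
  forall x y, avg s (fun h => f (y * h)%g) - avg s (fun h => f (x * h)%g) <= e &
  c = avg s (fun h => f (1 * h)%g) - e]]%classic.
have cross s r e e' : (0 < size s)%N -> (0 < size r)%N ->
  (forall x y, avg s (fun h => f (y * h)%g) - avg s (fun h => f (x * h)%g) <=
    e) ->
  (forall x y, avg r (fun h => f (h * y)%g) - avg r (fun h => f (h * x)%g) <=
    e') ->
  forall x y, `|avg s (fun h => f (x * h)%g) - avg r (fun h => f (h * y)%g)| <=
    e + e'.
  move=> s0 r0 /flat_near se /flat_near re x y.
  pose a := avg r (fun k => avg s (fun h => f (k * h)%g)).
  have ar : `|a - avg r (fun h => f (h * y)%g)| <= e'.
    by rewrite /a avg_exchange; apply: avg_near => // h; apply: re.
  have as' : `|a - avg s (fun h => f (x * h)%g)| <= e.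
    by apply: avg_near => // k; apply: se.
  rewrite distrC in as'.
  apply: (le_trans _ (lerD as' ar)); apply: le_trans (ler_normD _ _).
  by rewrite addrA subrK.
have P0 : has_sup P.
  split.
    have [s s0 sf] := ravg_flat fu ltr01.
    by exists (avg s (fun h => f (1 * h)%g) - 1), 1, s.
  have [r r0 rf] := lavg_flat fu ltr01.
  exists (avg r (fun h => f (h * 1)%g) + 1) => c [e [s [e0 s0 sf ->]]].
  have := cross _ _ _ _ s0 r0 sf rf 1%g 1%g; rewrite ler_distl => /andP[_]; lra.
pose c := sup P.
have c_near r e' : (0 < size r)%N -> 0 < e' ->
    (forall x y, avg r (fun h => f (h * y)%g) - avg r (fun h => f (h * x)%g) <=
      e') ->
    forall y, `|avg r (fun h => f (h * y)%g) - c| <= e'.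
  move=> r0 e'0 rf y; rewrite ler_distl; apply/andP; split; last first.
    rewrite -lerBlDr; apply/ler_addgt0Pl => e e0.
    have e2 : 0 < e / 2 by rewrite divr_gt0.
    have [s s0 sf] := ravg_flat fu e2.
    have : avg s (fun h => f (1 * h)%g) - e / 2 <= c.
      by apply: ub_le_sup; [case: P0|exists (e / 2), s].
    have := cross _ _ _ _ s0 r0 sf rf 1%g y; rewrite ler_distl => /andP[]; lra.
  rewrite lerBlDr; apply: ge_sup; first by case: P0.
  move=> _ [e [s [e0 s0 sf ->]]].
  have := cross _ _ _ _ s0 r0 sf rf 1%g y; rewrite ler_distl => /andP[_]; lra.
have lc : lamean f c.
  move=> e e0; have [r r0 rf] := lavg_flat fu e0.
  by exists r => //; apply: c_near.
exists c; split => // e e0.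
have e2 : 0 < e / 2 by rewrite divr_gt0.
have [s s0 sf] := ravg_flat fu e2; exists s => // x.
apply/ler_addgt0Pl => e' e'0; have e'2 : 0 < e' / 2 by rewrite divr_gt0.
have [r r0 rf] := lavg_flat fu e'2.
have := cross _ _ _ _ s0 r0 sf rf x 1%g; have := c_near _ _ r0 e'2 rf 1%g.
rewrite !ler_distl => /andP[? ?] /andP[? ?]; apply/andP; split; lra.
Qed.

Lemma lamean_mean f c : ucont f -> lamean f c -> mean f = c.
Proof. by move=> /meanP[fm _] /(mean_unique fm). Qed.

Lemma ramean_mean f c : ucont f -> ramean f c -> mean f = c.
Proof. by move=> /meanP[_ fm] /mean_unique/(_ fm). Qed.

Lemma ucontD f g : ucont f -> ucont g -> ucont (fun x => f x + g x).
Proof.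
move=> fu gu e e0; have e2 : 0 < e / 2 by rewrite divr_gt0.
have [r r0 fr] := fu _ e2; have [r' r'0 gr] := gu _ e2.
exists (Num.min r r'); first by rewrite lt_min r0.
move=> x y; rewrite lt_min => /andP[/fr fxy /gr gxy].
have -> : f x + g x - (f y + g y) = (f x - f y) + (g x - g y) by lra.
by apply: (le_trans (ler_normD _ _)); lra.
Qed.

Lemma ucontM f g : ucont f -> ucont g -> ucont (fun x => f x * g x).
Proof.
move=> fu gu e e0; have [M fM] := ucont_bounded fu.
have [N gN] := ucont_bounded gu.
have M0 : 0 <= M by apply: le_trans (normr_ge0 _) (fM 1%g).
have N0 : 0 <= N by apply: le_trans (normr_ge0 _) (gN 1%g).
pose e' := e / (M + N + 1); have e'0 : 0 < e' by rewrite divr_gt0 //; lra.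
have [r r0 fr] := fu _ e'0; have [r' r'0 gr] := gu _ e'0.
exists (Num.min r r'); first by rewrite lt_min r0.
move=> x y; rewrite lt_min => /andP[/fr fxy /gr gxy].
have -> : f x * g x - f y * g y = f x * (g x - g y) + (f x - f y) * g y by lra.
apply: (le_trans (ler_normD _ _)); rewrite !normrM.
apply: (@le_trans _ _ (M * e' + e' * N)).
  by apply: lerD; apply: ler_pM.
have -> : e = e' * (M + N + 1) by rewrite divfK // gt_eqF //; lra.
by lra.
Qed.

Lemma ucont_cst c : ucont (fun=> c).
Proof. by move=> e e0; exists 1 => // x y _; rewrite subrr normr0 ltW. Qed.

Lemma ucontX f n : ucont f -> ucont (fun x => f x ^+ n).
Proof.
move=> fu; elim: n => [|n IH]; first exact: ucont_cst.
by under eq_fun do rewrite exprS; apply: ucontM.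
Qed.

Lemma ucont_translr f k : ucont f -> ucont (fun x => f (x * k)%g).
Proof.
by move=> fu e /fu[r r0 fr]; exists r => // x y xy; apply: fr; rewrite dR.
Qed.

Lemma ucont_transll f k : ucont f -> ucont (fun x => f (k * x)%g).
Proof.
by move=> fu e /fu[r r0 fr]; exists r => // x y xy; apply: fr; rewrite dL.
Qed.

Lemma mean_cst c : mean (fun=> c) = c.
Proof.
apply: lamean_mean; first exact: ucont_cst.
by move=> e e0; exists [:: 1%g] => // x; rewrite avg_cst // subrr normr0 ltW.
Qed.

Lemma mean_translr f k : ucont f -> mean (fun x => f (x * k)%g) = mean f.
Proof.
move=> fu; apply: lamean_mean; first exact: ucont_translr.
move=> e e0; have [s s0 sf] := (meanP fu).2 _ e0; exists s => // x.
by under [X in avg _ X]eq_fun do rewrite -mulgA.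
Qed.

Lemma mean_transll f k : ucont f -> mean (fun x => f (k * x)%g) = mean f.
Proof.
move=> fu; apply: ramean_mean; first exact: ucont_transll.
move=> e e0; have [s s0 sf] := (meanP fu).1 _ e0; exists s => // x.
by under [X in avg _ X]eq_fun do rewrite mulgA.
Qed.

Lemma meanZ c f : ucont f -> mean (fun x => c * f x) = c * mean f.
Proof.
move=> fu; apply: lamean_mean; first by apply: ucontM => //; apply: ucont_cst.
move=> e e0; have c0 : 0 < `|c| + 1 by rewrite ltr_wpDl.
have [s s0 sf] := (meanP fu).2 _ (divr_gt0 e0 c0); exists s => // x.
rewrite avgZ -mulrBr normrM; apply: (le_trans (ler_wpM2l _ (sf x))) => //.
by rewrite mulrCA ger_pMr // ler_pdivrMr // mul1r lerDl.
Qed.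

(** A list that flattens f need not flatten g. So g is first averaged along the list chosen for f,
    and the result is flattened by a second list; the products of the two lists serve both
    functions. *)
Lemma meanD f g : ucont f -> ucont g ->
  mean (fun x => f x + g x) = mean f + mean g.
Proof.
move=> fu gu; apply: lamean_mean; first exact: ucontD.
move=> e e0; have e2 : 0 < e / 2 by rewrite divr_gt0.
have [s s0 sf] := (meanP fu).2 _ e2.
pose g1 x := avg s (fun k => g (k * x)%g).
have g1u : ucont g1.
  move=> e' e'0; have [r r0 gr] := gu _ e'0; exists r => // x y xy.
  by apply: avg_near2 => // k; apply: gr; rewrite dL.
have g1m : mean g1 = mean g.
  apply: ramean_mean => // e' e'0; have [r r0 rg] := (meanP gu).1 _ e'0.
  exists r => // x; rewrite /g1 avg_exchange; apply: avg_near => // k.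
  by under [X in avg _ X]eq_fun do rewrite mulgA.
have [t t0 tg] := (meanP g1u).2 _ e2.
exists (allpairs (fun j k => (k * j)%g) t s);
  first by rewrite size_allpairs muln_gt0 t0.
move=> x; rewrite avgD !avg_allpairs.
set a := avg t _; set b := avg t _.
have am : `|a - mean f| <= e / 2.
  apply: avg_near => // h.
  by under [X in avg _ X]eq_fun do rewrite -mulgA.
have bm : `|b - mean g| <= e / 2.
  rewrite -g1m; apply: le_trans (tg x); rewrite le_eqVlt; apply/orP; left.
  apply/eqP; congr (`|_ - _|); congr avg; apply/funext => j; congr avg.
  by apply/funext => k; rewrite mulgA.
have -> : a + b - (mean f + mean g) = (a - mean f) + (b - mean g) by lra.
by apply: (le_trans (ler_normD _ _)); lra.
Qed.

Lemma mean_ge0 f : ucont f -> (forall x, 0 <= f x) -> 0 <= mean f.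
Proof.
move=> fu f0; apply/ler_addgt0Pr => e e0.
have [s s0 sf] := (meanP fu).1 _ e0.
have := sf 1%g; rewrite ler_distl => /andP[_].
apply: le_trans; rewrite -(avg_cst 0 s0); exact: ler_avg.
Qed.

Lemma meanB f g : ucont f -> ucont g ->
  mean (fun x => f x - g x) = mean f - mean g.
Proof.
move=> fu gu; rewrite -(mulN1r (mean g)) -meanZ // -meanD //.
  by congr mean; apply/funext => x; rewrite mulN1r.
by apply: ucontM => //; apply: ucont_cst.
Qed.

Lemma ucontB f g : ucont f -> ucont g -> ucont (fun x => f x - g x).
Proof.
move=> fu gu.
have -> : (fun x => f x - g x) = (fun x => f x + -1 * g x).
  by apply/funext => x; rewrite mulN1r.
by apply: ucontD => //; apply: ucontM => //; apply: ucont_cst.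
Qed.

Lemma ler_mean f g : ucont f -> ucont g -> (forall x, f x <= g x) ->
  mean f <= mean g.
Proof.
move=> fu gu fg; rewrite -subr_ge0 -meanB //.
by apply: mean_ge0 => [|x]; [exact: ucontB|rewrite subr_ge0].
Qed.

Lemma mean_norm_le f e : ucont f -> (forall x, `|f x| <= e) -> `|mean f| <= e.
Proof.
move=> fu fe; rewrite ler_norml -[in X in _ && X](mean_cst e) -(mean_cst (- e)).
by apply/andP; split; apply: ler_mean => //; try exact: ucont_cst;
  move=> x; have := fe x; rewrite ler_norml => /andP[].
Qed.

End InvariantMean.

(** * Unit quaternions *)

Section Quaternions.
Variable R : realType.
Local Notation quat := (R * R * R * R)%type.

Definition qmul (x y : quat) : quat :=
  let: (x0, x1, x2, x3) := x in let: (y0, y1, y2, y3) := y in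
  (x0 * y0 - x1 * y1 - x2 * y2 - x3 * y3,
   x0 * y1 + x1 * y0 + x2 * y3 - x3 * y2,
   x0 * y2 - x1 * y3 + x2 * y0 + x3 * y1,
   x0 * y3 + x1 * y2 - x2 * y1 + x3 * y0).

Definition qconj (x : quat) : quat :=
  let: (x0, x1, x2, x3) := x in (x0, - x1, - x2, - x3).

Definition qdot (x y : quat) : R :=
  x.1.1.1 * y.1.1.1 + x.1.1.2 * y.1.1.2 + x.1.2 * y.1.2 + x.2 * y.2.

Lemma qmulA : associative qmul.
Proof.
by move=> [[[? ?] ?] ?] [[[? ?] ?] ?] [[[? ?] ?] ?]; rewrite /qmul;
  congr (_, _, _, _); ring.
Qed.

Lemma qdotM x y : qdot (qmul x y) (qmul x y) = qdot x x * qdot y y.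
Proof. by move: x y => [[[? ?] ?] ?] [[[? ?] ?] ?]; rewrite /qdot /=; ring. Qed.

Record usphere := Usphere { uval :> quat; _ : qdot uval uval == 1 }.
HB.instance Definition _ := [isSub for uval].
HB.instance Definition _ := [Choice of usphere by <:].

Lemma usphereP (x : usphere) : qdot x x = 1.
Proof. by case: x => x /= /eqP. Qed.

Fact usphere_mul_subproof (x y : usphere) :
  qdot (qmul x y) (qmul x y) == 1.
Proof. by rewrite qdotM !usphereP mulr1. Qed.
Fact usphere_inv_subproof (x : usphere) : qdot (qconj x) (qconj x) == 1.
Proof.
by rewrite -[1](usphereP x); case: x => [[[[? ?] ?] ?] ?];
  rewrite /qdot /= !mulrNN.
Qed.
Fact usphere_one_subproof : qdot (1, 0, 0, 0) (1, 0, 0, 0) == 1.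
Proof. by rewrite /qdot /= !mulr0 !addr0 mulr1. Qed.

Definition usphere_mul x y := Usphere (usphere_mul_subproof x y).
Definition usphere_inv x := Usphere (usphere_inv_subproof x).
Definition usphere_one := Usphere usphere_one_subproof.

Fact usphere_mulA : associative usphere_mul.
Proof. by move=> x y z; apply: val_inj; apply: qmulA. Qed.
Fact usphere_mul1g : left_id usphere_one usphere_mul.
Proof.
move=> [[[[? ?] ?] ?] ?]; apply: val_inj; rewrite /= /qmul /=.
by congr (_, _, _, _); ring.
Qed.
Fact usphere_mulg1 : right_id usphere_one usphere_mul.
Proof.
move=> [[[[? ?] ?] ?] ?]; apply: val_inj; rewrite /= /qmul /=.
by congr (_, _, _, _); ring.
Qed.
Fact usphere_mulVg : left_inverse usphere_one usphere_inv usphere_mul.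
Proof.
move=> x; apply: val_inj; have := usphereP x; case: x => [[[[? ?] ?] ?] ?].
by rewrite /qdot /= => h; congr (_, _, _, _); try ring; rewrite -h; ring.
Qed.
Fact usphere_mulgV : right_inverse usphere_one usphere_inv usphere_mul.
Proof.
move=> x; apply: val_inj; have := usphereP x; case: x => [[[[? ?] ?] ?] ?].
by rewrite /qdot /= => h; congr (_, _, _, _); try ring; rewrite -h; ring.
Qed.
HB.instance Definition _ := isGroup.Build usphere usphere_mulA usphere_mul1g
  usphere_mulg1 usphere_mulVg usphere_mulgV.

Definition qvec (i : 'I_3) (x y : R) : quat :=
  match val i with 0%N => (x, y, 0, 0) | 1%N => (x, 0, y, 0) | _ => (x, 0, 0,
    y) end.

Fact qexp_subproof i t :
  qdot (qvec i (cos t) (sin t)) (qvec i (cos t) (sin t)) == 1.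
Proof.
apply/eqP; rewrite -(cos2Dsin2 t) /qdot.
by case: i => [[|[|[|]]] ?] //=; ring.
Qed.
Definition qexp i t : usphere := Usphere (qexp_subproof i t).
Fact qunit_subproof i : qdot (qvec i 0 1) (qvec i 0 1) == 1.
Proof. by apply/eqP; rewrite /qdot; case: i => [[|[|[|]]] ?] //=; ring. Qed.
(** The imaginary unit is itself a point of the sphere: differentiating [dot h x] along the i-th
    field amounts to replacing h by [h * qunit i]. *)
Definition qunit i : usphere := Usphere (qunit_subproof i).
Definition qneg (x : quat) : quat :=
  (- x.1.1.1, - x.1.1.2, - x.1.2, - x.2).
Fact qopp_subproof (x : usphere) : qdot (qneg x) (qneg x) == 1.
Proof. by rewrite /qdot /= !mulrNN; apply/eqP/usphereP. Qed.
Definition qopp x : usphere := Usphere (qopp_subproof x).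

Definition dot (x y : usphere) := qdot x y.

Lemma dotC x y : dot x y = dot y x.
Proof. by rewrite /dot /qdot; ring. Qed.

Lemma dotxx x : dot x x = 1. Proof. exact: usphereP. Qed.

Lemma dot_mull k x y : dot (k * x)%g (k * y)%g = dot x y.
Proof.
(* The factor [qdot k k], equal to 1, makes the claim a polynomial identity. *)
have -> : dot x y = qdot k k * dot x y by rewrite usphereP mul1r.
rewrite /dot.
by move: k x y => [[[[? ?] ?] ?] ?] [[[[? ?] ?] ?] ?] [[[[? ?] ?] ?] ?];
  rewrite /qdot /=; ring.
Qed.

Lemma dot_mulr k x y : dot (x * k)%g (y * k)%g = dot x y.
Proof.
have -> : dot x y = qdot k k * dot x y by rewrite usphereP mul1r.
rewrite /dot.
by move: k x y => [[[[? ?] ?] ?] ?] [[[[? ?] ?] ?] ?] [[[[? ?] ?] ?] ?];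
  rewrite /qdot /=; ring.
Qed.

Lemma dot_le1 x y : `|dot x y| <= 1.
Proof.
have := usphereP x; have := usphereP y; rewrite /dot.
move: x y => [[[[a b] c] d] ?] [[[[e f] g] h] ?]; rewrite /qdot /= => h1 h2.
rewrite ler_norml; apply/andP; split.
  have := sqr_ge0 (a + e); have := sqr_ge0 (b + f).
  by have := sqr_ge0 (c + g); have := sqr_ge0 (d + h); nra.
have := sqr_ge0 (a - e); have := sqr_ge0 (b - f).
by have := sqr_ge0 (c - g); have := sqr_ge0 (d - h); nra.
Qed.

Lemma dot_opp x y : dot x (qopp y) = - dot x y.
Proof. by rewrite /dot /qdot /=; ring. Qed.

Lemma qopp_mul x y : qopp (x * y)%g = (qopp x * y)%g.
Proof.
apply: val_inj; move: x y => [[[[? ?] ?] ?] ?] [[[[? ?] ?] ?] ?] /=.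
by rewrite /qneg /=; congr (_, _, _, _); ring.
Qed.

Lemma mul_qexp_pi i x : (x * qexp i pi)%g = qopp x.
Proof.
apply: val_inj; move: x => [[[[? ?] ?] ?] ?] /=; rewrite /qneg cospi sinpi.
by case: i => [[|[|[|]]] ?] //=; congr (_, _, _, _); ring.
Qed.

Lemma qexpD i s t : (qexp i s * qexp i t)%g = qexp i (s + t).
Proof.
apply: val_inj; rewrite /= cosD sinD.
by case: i => [[|[|[|]]] ?] //=; congr (_, _, _, _); ring.
Qed.

Lemma qexp0 i : qexp i 0 = 1%g.
Proof.
by apply: val_inj; rewrite /= cos0 sin0; case: i => [[|[|[|]]] ?].
Qed.

Lemma dot_qexp i t x y :
  dot (x * qexp i t)%g y = cos t * dot x y + sin t * dot (x * qunit i)%g y.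
Proof.
rewrite /dot; move: x y => [[[[? ?] ?] ?] ?] [[[[? ?] ?] ?] ?];
  rewrite /qdot /=.
by case: i => [[|[|[|]]] ?] //=; ring.
Qed.

Lemma dot_mul_qexp i t x : dot (x * qexp i t)%g x = cos t.
Proof.
rewrite dot_qexp dotxx -[RHS]addr0 mulr1; congr (_ + _).
rewrite /dot; move: x => [[[[? ?] ?] ?] ?]; rewrite /qdot /=.
by case: i => [[|[|[|]]] ?] //=; ring.
Qed.

Local Notation i0 := (0 : 'I_3).
Local Notation i1 := (1 : 'I_3).
Local Notation i2 := (2%:R : 'I_3).

Lemma dot_qunit2 i x y : dot (x * qunit i * qunit i)%g y = - dot x y.
Proof.
rewrite /dot; move: x y => [[[[? ?] ?] ?] ?] [[[[? ?] ?] ?] ?];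
  rewrite /qdot /=.
by case: i => [[|[|[|]]] ?] //=; ring.
Qed.

Lemma dot_qunit01 x y :
  (dot (x * qunit i0 * qunit i1)%g y = dot (x * qunit i2)%g y) *
  (dot (x * qunit i1 * qunit i0)%g y = - dot (x * qunit i2)%g y).
Proof.
by split; rewrite /dot; move: x y => [[[[? ?] ?] ?] ?] [[[[? ?] ?] ?] ?];
  rewrite /qdot /=; ring.
Qed.

Lemma dot_qunit12 x y :
  (dot (x * qunit i1 * qunit i2)%g y = dot (x * qunit i0)%g y) *
  (dot (x * qunit i2 * qunit i1)%g y = - dot (x * qunit i0)%g y).
Proof.
by split; rewrite /dot; move: x y => [[[[? ?] ?] ?] ?] [[[[? ?] ?] ?] ?];
  rewrite /qdot /=; ring.
Qed.

Lemma dot_qunit20 x y :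
  (dot (x * qunit i2 * qunit i0)%g y = dot (x * qunit i1)%g y) *
  (dot (x * qunit i0 * qunit i2)%g y = - dot (x * qunit i1)%g y).
Proof.
by split; rewrite /dot; move: x y => [[[[? ?] ?] ?] ?] [[[[? ?] ?] ?] ?];
  rewrite /qdot /=; ring.
Qed.

(** The point x and its products with the three units form an orthonormal basis of the quaternions,
    in which these are the coordinates of y. *)
Lemma dot_parseval x y : dot (x * qunit i0)%g y ^+ 2 +
  dot (x * qunit i1)%g y ^+ 2 + dot (x * qunit i2)%g y ^+ 2 = 1 - dot x y ^+ 2.
Proof.
have -> : 1 - dot x y ^+ 2 = qdot x x * qdot y y - dot x y ^+ 2.
  by rewrite !usphereP mulr1.
rewrite /dot; move: x y => [[[[? ?] ?] ?] ?] [[[[? ?] ?] ?] ?].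
by rewrite /qdot /=; ring.
Qed.

Definition dist (x y : usphere) := 1 - dot x y.

Lemma distC x y : dist x y = dist y x.
Proof. by rewrite /dist dotC. Qed.
Lemma dist_mull k x y : dist (k * x)%g (k * y)%g = dist x y.
Proof. by rewrite /dist dot_mull. Qed.
Lemma dist_mulr k x y : dist (x * k)%g (y * k)%g = dist x y.
Proof. by rewrite /dist dot_mulr. Qed.

Lemma continuous_quat (T : topologicalType) (f0 f1 f2 f3 : T -> R) :
  continuous f0 -> continuous f1 -> continuous f2 -> continuous f3 ->
  continuous (fun x => (f0 x, f1 x, f2 x, f3 x)).
Proof.
have pair (U V : topologicalType) (f : T -> U) (g : T -> V) :
    continuous f -> continuous g -> continuous (fun x => (f x, g x)).
  move=> fc gc x.
  exact: (@cvg_pair _ _ _ _ (nbhs (f x)) (nbhs (g x)) _ _ _ _ _ (fc x) (gc x)).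
by move=> c0 c1 c2 c3;
  exact: (pair _ _ _ _ (pair _ _ _ _ (pair _ _ _ _ c0 c1) c2) c3).
Qed.

Lemma continuous_coord : [/\ continuous (fun x : quat => x.1.1.1),
  continuous (fun x : quat => x.1.1.2), continuous (fun x : quat => x.1.2)
  & continuous (fun x : quat => x.2)].
Proof.
have fstc (S T : topologicalType) : continuous (@fst S T).
  by move=> [x y]; apply: cvg_fst.
have sndc (S T : topologicalType) : continuous (@snd S T).
  by move=> [x y]; apply: cvg_snd.
have comp (A B C : topologicalType) (f : A -> B) (g : B -> C) :
    continuous f -> continuous g -> continuous (fun x => g (f x)).
  by move=> fc gc x; apply: continuous_comp; [exact: fc|exact: gc].
have ff := comp _ _ _ _ _ (fstc (R * R * R)%type R) (fstc (R * R)%type R).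
split.
- exact: comp ff (fstc R R).
- exact: comp ff (sndc R R).
- exact: comp (fstc _ _) (sndc _ _).
exact: sndc.
Qed.

Lemma continuous_qdot (T : topologicalType) (f g : T -> quat) :
  continuous f -> continuous g -> continuous (fun x => qdot (f x) (g x)).
Proof.
move=> fc gc x; have [c0 c1 c2 c3] := continuous_coord.
have comp (h : quat -> R) : continuous h -> h (f y) @[y --> x] --> h (f x) /\
    h (g y) @[y --> x] --> h (g x).
  by move=> hc; split; [apply: (continuous_comp (fc x)); apply: hc
    |apply: (continuous_comp (gc x)); apply: hc].
by rewrite /qdot; do 3?[apply: cvgD]; apply: cvgM;
  (apply: (comp _ c0).1 || apply: (comp _ c0).2 || apply: (comp _ c1).1
   || apply: (comp _ c1).2 || apply: (comp _ c2).1 || apply: (comp _ c2).2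
   || apply: (comp _ c3).1 || apply: (comp _ c3).2).
Qed.

Definition qsphere : set quat := [set x | qdot x x = 1].

Lemma qsphere_compact : compact qsphere.
Proof.
pose I : set R := [set` `[(-1 : R), 1]].
have Ic : compact (I `*` I `*` I `*` I).
  by do 3![apply: compact_setX; last exact: segment_compact];
    exact: segment_compact.
apply: (subclosed_compact _ Ic).
  have -> : qsphere = (fun x => qdot x x) @^-1` [set 1] by [].
  apply: closed_comp; last exact: closed_eq.
  by move=> x _; apply: continuous_qdot => y.
move=> [[[a b] c] d]; rewrite /qsphere /qdot /I /= !in_itv /= => h.
have := sqr_ge0 a; have := sqr_ge0 b; have := sqr_ge0 c;
  have := sqr_ge0 d => ? ? ? ?.
have small (x : R) : x ^+ 2 <= 1 -> -1 <= x <= 1.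
  by move=> x1; rewrite -ler_norml -(ler_pXn2r (n := 2)) ?nnegrE // real_normK
    ?num_real // expr1n.
by split; [split; [split|]|]; apply: small; lra.
Qed.

Lemma dist_bounded r : 0 < r ->
  exists s : seq usphere, forall g, exists2 h, h \in s & dist g h < r.
Proof.
move=> r0; have /compact_near_coveringP cov := qsphere_compact.
(* With the filter of finite lists under inclusion, the near-covering form of compactness yields a
   finite net. *)
pose F : set_system (seq usphere) :=
  [set A | exists s0 : seq usphere,
    forall s : seq usphere, {subset s0 <= s} -> A s].
have FF : Filter F.
  split; first by exists [::].
    move=> A B [s sA] [t tB]; exists (s ++ t) => u stu.
    by split; [apply: sA|apply: tB] => h hs; apply: stu;
      rewrite mem_cat hs ?orbT.
  by move=> A B AB [s sA]; exists s => t /sA /AB.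
pose P (s : seq usphere) x := exists2 h : usphere, h \in s & 1 - qdot x h < r.
have [x xS|s sP] := cov _ F P FF.
  have xS' : qdot x x == 1 by apply/eqP.
  exists ([set y | 1 - qdot y x < r], [set s : seq usphere | Usphere xS' \in
    s]); last first.
    by move=> [y s] /= [yx xs]; exists (Usphere xS').
  split => /=; last by exists [:: Usphere xS'] => s; apply; rewrite inE.
  have : open ((fun y => 1 - qdot y x) @^-1` [set z | z < r]).
    apply: open_comp; last exact: open_lt.
    move=> y _; apply: cvgB; first exact: cvg_cst.
    by apply: continuous_qdot => z; [exact: cvg_id|exact: cst_continuous].
  by move=> op; apply: open_nbhs_nbhs; split => //=; rewrite xS subrr.
exists s => g; have [h hs gh] := sP s (fun=> id) (uval g) (usphereP g).
by exists h.
Qed.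

Lemma dist_bimetric : bimetric dist.
Proof.
by split; [exact: distC|exact: dist_mull|exact: dist_mulr|exact: dist_bounded].
Qed.

Lemma continuous_ucont (F : quat -> R) : {within qsphere, continuous F} ->
  ucont dist (fun x : usphere => F x).
Proof.
move=> /subspace_continuousP Fc e e0.
have /compact_near_coveringP cov := qsphere_compact.
have := cov R (0^'+) (fun r x => qsphere x -> forall y, qsphere y ->
  1 - qdot x y < r -> `|F x - F y| <= e) _.
case.
- move=> x0 x0S; have e2 : 0 < e / 2 by rewrite divr_gt0.
  have : \forall y \near within qsphere (nbhs x0), `|F x0 - F y| < e / 2.
    by have /cvgrPdist_lt := Fc x0 x0S; apply.
  rewrite near_withinE => /nbhs_ballP[dl /= dl0 Fdl].
  have dl2 : 0 < dl / 2 by rewrite divr_gt0.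
  exists (ball x0 (dl / 2), [set r | r < (dl / 2) ^+ 2 / 2]).
    split; first exact: nbhsx_ballx.
    by apply: nbhs_right_lt; rewrite divr_gt0 // exprn_gt0.
  move=> [x r] /= [xb rlt] xS y yS xyr.
  have yb : ball x (dl / 2) y.
    (* On the sphere |x - y|^2 = 2 (1 - qdot x y) bounds the square of each coordinate gap; whence
       the radius (dl / 2)^2 / 2 above. *)
    have close (u v : R) : (u - v) ^+ 2 <= 2 * (1 - qdot x y) -> ball u (dl /
      2) v.
      move=> h; rewrite /ball /= -(ltr_pXn2r (n := 2)) ?nnegrE // ?ltW //.
      rewrite real_normK ?num_real //; lra.
    move: xS yS close; rewrite /qsphere /qdot /=.
    move: x y {xb xyr} => [[[a b] c] d] [[[a' b'] c'] d'] /= h1 h2 close.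
    have := sqr_ge0 (a - a'); have := sqr_ge0 (b - b').
    have := sqr_ge0 (c - c'); have := sqr_ge0 (d - d') => ? ? ? ?.
    by split; [split; [split|]|]; apply: close; rewrite /=; lra.
  have Fx : `|F x0 - F x| < e / 2.
    by apply: Fdl => //; apply: le_ball xb; lra.
  have Fy : `|F x0 - F y| < e / 2.
    by apply: Fdl => //; have := ball_triangle xb yb; rewrite -splitr.
  have -> : F x - F y = (F x0 - F y) - (F x0 - F x) by lra.
  by apply: (le_trans (ler_normB _ _)); lra.
move=> r /= r0 rP; exists (r / 2); first by rewrite divr_gt0.
move=> x y xy; apply: (rP (r / 2)) => //=.
- by rewrite sub0r normrN gtr0_norm ?divr_gt0 //; lra.
- by rewrite divr_gt0.
- exact: usphereP.
- exact: usphereP.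
exact: usphereP.
Qed.

End Quaternions.

(** * Calculus on the 3-sphere *)

Section SphereCalculus.
Variable R : realType.
Local Notation G := (usphere R).
Local Notation uc := (ucont (@dist R)).
Local Notation m := (@mean R G).
Implicit Types (f g w : G -> R) (x y h k : G) (i j : 'I_3).

Let dP := @dist_bimetric R.

(** The derivative of f along the left-invariant field x e_i. Uniform continuity of both functions
    gives them means and makes the difference quotients converge uniformly. *)
Definition isE i f f' := [/\ uc f, uc f'
  & forall x, is_derive (0 : R) (1 : R) (fun t => f (x * qexp i t)%g) (f' x)].

Lemma isE_at i f f' x t : isE i f f' ->
  is_derive t (1 : R) (fun s => f (x * qexp i s)%g) (f' (x * qexp i t)%g).
Proof.
move=> [_ _ ff']; pose y := (x * qexp i t)%g.
have -> : (fun s => f (x * qexp i s)%g) =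
    (fun s => f (y * qexp i s)%g) \o (fun s => s - t).
  by apply/funext => s /=; rewrite /y -mulgA qexpD addrC subrK.
rewrite -[f' _]mulr1; apply: is_derive1_comp; first by rewrite subrr.
by have := is_deriveB (is_derive_id t (1 : R)) (is_derive_cst t t 1);
  rewrite subr0.
Qed.

Lemma isE_mvt i f f' x t : isE i f f' ->
  exists2 c, `|c| <= `|t| &
    f (x * qexp i t)%g - f x = f' (x * qexp i c)%g * t.
Proof.
move=> ff'; have fd s := @isE_at i f f' x s ff'.
have fc a b : {within `[a, b], continuous (fun s => f (x * qexp i s)%g)}.
  apply: continuous_subspaceT => s.
  by apply: differentiable_continuous; apply/derivable1_diffP; case: (fd s).
have e0 : f x = f (x * qexp i 0)%g by rewrite qexp0 mulg1.
have [t0|t0] := leP 0 t.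
  have [c] := MVT_segment t0 (fun s _ => fd s) (fc 0 t).
  rewrite in_itv /= subr0 -e0 => /andP[c0 ct] fE; exists c => //.
  by rewrite !ger0_norm // (le_trans c0).
have [c] := MVT_segment (ltW t0) (fun s _ => fd s) (fc t 0).
rewrite in_itv /= -e0 sub0r => /andP[tc c0] fE; exists c.
  by rewrite !ler0_norm ?lerN2 // ltW.
by rewrite -[LHS]opprB fE mulrN opprK.
Qed.

Lemma isE_unif i f f' e : isE i f f' -> 0 < e -> exists2 dl, 0 < dl &
  forall t x, t != 0 -> `|t| < dl ->
    `|(f (x * qexp i t)%g - f x) / t - f' x| <= e.
Proof.
move=> ff' e0; have [_ f'u _] := ff'; have [r r0 f'r] := f'u _ e0.
have : \forall c \near (0 : R), `|cos 0 - cos c| < r.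
  by have /cvgrPdist_lt := @continuous_cos R 0; apply.
move=> /nbhs_ballP[dl /= dl0 dlr]; exists dl => // t x t0 tdl.
have [c ct ->] := isE_mvt x t ff'; rewrite mulfK //.
apply: f'r; rewrite /dist dot_mul_qexp -(@cos0 R).
apply: le_lt_trans (ler_norm _) _; apply: dlr.
by rewrite /ball /= sub0r normrN (le_lt_trans ct).
Qed.

(** The difference quotients have mean zero by invariance and converge uniformly. Applied to
    products, this is integration by parts. *)
Lemma isE_mean0 i f f' : isE i f f' -> m f' = 0.
Proof.
move=> ff'; have [fu f'u _] := ff'.
apply/eqP; rewrite -normr_le0; apply/ler_addgt0Pl => e e0; rewrite addr0.
have [dl dl0 dle] := isE_unif ff' e0.
pose t := dl / 2; have t0 : 0 < t by rewrite divr_gt0.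
have ftu : uc (fun x => f (x * qexp i t)%g) by apply: (ucont_translr dP).
have -> : m f' = - m (fun x => t^-1 * (f (x * qexp i t)%g - f x) - f' x).
  rewrite (meanB dP) //; last first.
    by apply: (ucontM dP); [exact: ucont_cst|exact: (ucontB dP)].
  rewrite (meanZ dP); last exact: (ucontB dP).
  by rewrite (meanB dP) // (mean_translr dP) // subrr mulr0 sub0r opprK.
rewrite normrN; apply: (mean_norm_le dP) => [|x].
  apply: (ucontB dP) => //.
  by apply: (ucontM dP); [exact: ucont_cst|exact: (ucontB dP)].
by rewrite mulrC; apply: dle; rewrite ?gt_eqF // gtr0_norm // /t; lra.
Qed.

Lemma isE_add i f f' g g' : isE i f f' -> isE i g g' ->
  isE i (fun x => f x + g x) (fun x => f' x + g' x).
Proof.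
move=> [? ? ff'] [? ? gg']; split; try exact: ucontD.
by move=> x; apply: is_deriveD.
Qed.

Lemma isE_mul i f f' g g' : isE i f f' -> isE i g g' ->
  isE i (fun x => f x * g x) (fun x => f' x * g x + f x * g' x).
Proof.
move=> [? ? ff'] [? ? gg']; split; first exact: (ucontM dP).
  by apply: ucontD; exact: (ucontM dP).
move=> x; have := is_deriveM (ff' x) (gg' x); rewrite qexp0 mulg1.
by rewrite -![_ *: _]/(_ * _) addrC (mulrC (g x)).
Qed.

Lemma isE_cst i c : isE i (fun=> c) (fun=> 0).
Proof. by split; try exact: ucont_cst; move=> x; exact: is_derive_cst. Qed.

Lemma isE_scale i c f f' : isE i f f' ->
  isE i (fun x => c * f x) (fun x => c * f' x).
Proof.
move=> ff'; have := isE_mul (isE_cst i c) ff'; congr isE.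
by apply/funext => x; rewrite mul0r add0r.
Qed.

Lemma isE_exp i f f' n : isE i f f' ->
  isE i (fun x => f x ^+ n) (fun x => n%:R * f x ^+ n.-1 * f' x).
Proof.
move=> ff'; elim: n => [|n IH].
  by have := isE_cst i 1; congr isE; apply/funext => x; rewrite !mul0r.
under eq_fun do rewrite exprS.
have := isE_mul ff' IH; congr isE; apply/funext => x /=.
by case: n {IH} => [|n] /=; rewrite -?natr1 ?exprS; ring.
Qed.

Lemma ucont_dot k y : uc (fun h => dot (h * k)%g y).
Proof.
have -> : (fun h => dot (h * k)%g y) = (fun h => dot h (y * k^-1)%g).
  by apply/funext => h; rewrite -(dot_mulr k^-1) mulgK.
pose z : G := (y * k^-1)%g; rewrite /dot -/z.
apply: (continuous_ucont (F := fun u => qdot u (uval z))).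
apply: continuous_subspaceT.
by apply: continuous_qdot => v; [exact: cvg_id|exact: cst_continuous].
Qed.

Lemma isE_dot i k y :
  isE i (fun h => dot (h * k)%g y) (fun h => dot (h * qunit R i * k)%g y).
Proof.
split; first exact: ucont_dot.
  by under eq_fun do rewrite -mulgA; exact: ucont_dot.
move=> x; have e z : dot (z * k)%g y = dot z (y * k^-1)%g.
  by rewrite -(dot_mulr k^-1) mulgK.
have -> : (fun t => dot (x * qexp i t * k)%g y) =
    cos * cst (dot x (y * k^-1)%g) + sin * cst (dot (x * qunit R i)%g (y *
      k^-1)%g).
  by apply/funext => t; rewrite e dot_qexp.
have := is_deriveD (is_deriveM (is_derive_cos 0) (is_derive_cst (dot x (y *
  k^-1)%g) (0 : R) 1))
  (is_deriveM (is_derive_sin 0) (is_derive_cst (dot (x * qunit R i)%g (y *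
    k^-1)%g) (0 : R) 1)).
rewrite /cst sin0 cos0 -!e -![_ *: _]/(_ * _).
by rewrite oppr0 !mulr0 mulr1 !add0r.
Qed.

(* Convolution with the zonal kernel [(h, x) |-> dot h x ^+ n]; it commutes
   with the left-invariant fields and its image consists of polynomials. *)
Definition zonal n w x := m (fun h => w h * dot h x ^+ n).

Lemma ucont_dotX n y : uc (fun h => dot h y ^+ n).
Proof.
apply: (ucontX dP); have := ucont_dot 1%g y.
by under eq_fun do rewrite mulg1.
Qed.

Lemma ucont_zonal_arg n w x : uc w -> uc (fun h => w h * dot h x ^+ n).
Proof. by move=> wu; apply: (ucontM dP) => //; exact: ucont_dotX. Qed.

Lemma dotX_le1 n x y : `|dot x y ^+ n| <= 1.
Proof. by rewrite normrX exprn_ile1 // dot_le1. Qed.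

Lemma zonalD n w w' x : uc w -> uc w' ->
  zonal n (fun h => w h + w' h) x = zonal n w x + zonal n w' x.
Proof.
move=> wu wu'; rewrite -(meanD dP); try exact: ucont_zonal_arg.
by congr m; apply/funext => h; rewrite mulrDl.
Qed.

Lemma zonalZ n c w x : uc w -> zonal n (fun h => c * w h) x = c * zonal n w x.
Proof.
move=> wu; rewrite -(meanZ dP); try exact: ucont_zonal_arg.
by congr m; apply/funext => h; rewrite mulrA.
Qed.

Lemma zonal_near n w w' x e : uc w -> uc w' ->
  (forall h, `|w h - w' h| <= e) -> `|zonal n w x - zonal n w' x| <= e.
Proof.
move=> wu wu' ww'; rewrite -(meanB dP); try exact: ucont_zonal_arg.
apply: (mean_norm_le dP) => [|h].
  by apply: (ucontB dP); exact: ucont_zonal_arg.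
rewrite -mulrBl normrM -[e]mulr1.
by apply: ler_pM => //; exact: dotX_le1.
Qed.

Lemma zonal_transl n w k x : uc w ->
  zonal n w (k * x)%g = zonal n (fun h => w (k * h)%g) x.
Proof.
move=> wu; rewrite /zonal -[LHS](mean_transll dP k);
  last exact: ucont_zonal_arg.
by congr m; apply/funext => h; rewrite dot_mull.
Qed.

Lemma zonal_transr n w k x : uc w ->
  zonal n w (x * k)%g = zonal n (fun h => w (h * k)%g) x.
Proof.
move=> wu; rewrite /zonal -[LHS](mean_translr dP k);
  last exact: ucont_zonal_arg.
by congr m; apply/funext => h; rewrite dot_mulr.
Qed.

Lemma ucont_zonal n w : uc w -> uc (zonal n w).
Proof.
move=> wu e e0; have [r r0 wr] := wu _ e0; exists r => // x y xy.
have -> : x = ((x * y^-1) * y)%g by rewrite mulgVK.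
rewrite zonal_transl //; apply: zonal_near => //.
  exact: (ucont_transll dP).
move=> h; apply: wr; rewrite -[X in dist _ X]mul1g (dist_mulr h).
by rewrite -(dist_mulr y) mulgVK mul1g.
Qed.

(** A right translation of the argument passes to [w], so the difference quotients of the
    convolution are the convolutions of those of [w]. *)
Lemma isE_zonal n i w w' : isE i w w' -> isE i (zonal n w) (zonal n w').
Proof.
move=> ww'; have [wu wu' _] := ww'; split; try exact: ucont_zonal.
move=> x; have wtu t : uc (fun h => w (h * qexp i t)%g).
  exact: (ucont_translr dP).
have cvg : (fun t : R => t^-1 *: (zonal n w (x * qexp i (t *: (1 : R)%R + 0))%g
  -
    zonal n w (x * qexp i 0)%g)) @ 0^' --> zonal n w' x.
  apply/cvgrPdist_le => e e0; have [dl dl0 dle] := isE_unif ww' e0.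
  exists dl => // t; rewrite /ball_ /= sub0r normrN => tdl t0.
  rewrite qexp0 mulg1 addr0 zonal_transr // distrC -[_ *: _]/(_ * _).
  rewrite -[t *: _]/(t * 1) mulr1.
  have -> : t^-1 * (zonal n (fun h => w (h * qexp i t)%g) x - zonal n w x) =
      zonal n (fun h => (w (h * qexp i t)%g - w h) / t) x.
    rewrite -[- zonal n w x]mulN1r -zonalZ // -zonalD //; last first.
      by apply: (ucontM dP) => //; exact: ucont_cst.
    rewrite -zonalZ; last first.
      by apply: ucontD => //; apply: (ucontM dP) => //; exact: ucont_cst.
    by congr (zonal n _ x); apply/funext => h; rewrite mulN1r mulrC.
  apply: zonal_near => //; last by move=> h; apply: dle.
  by apply: (ucontM dP); [exact: (ucontB dP)|exact: ucont_cst].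
apply: DeriveDef; first by apply/cvg_ex; exists (zonal n w' x).
by apply/cvg_lim.
Qed.

End SphereCalculus.

(** * Zonal kernels: commutators, Casimir relation, moments and concentration *)

Section ZonalKernel.
Variable R : realType.
Local Notation G := (usphere R).
Local Notation uc := (ucont (@dist R)).
Local Notation m := (@mean R G).
Local Notation qu := (qunit R).
Implicit Types (f g w : G -> R) (x y h k : G) (i j : 'I_3).

Let dP := @dist_bimetric R.

Lemma ucont_dot1 x : uc (fun h => dot h x).
Proof. by have := ucont_dotX 1 x; under eq_fun do rewrite expr1. Qed.

Lemma ucont_dot2 k k' y : uc (fun h => dot (h * k * k')%g y).
Proof. by have := ucont_dot (k * k')%g y; under eq_fun do rewrite mulgA. Qed.

Ltac ucont_tac := repeat first
  [ assumption
  | match goal with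
    | |- ucont _ (fun _ => ?c) => exact: ucont_cst
    | |- ucont _ (fun z => @?F z - @?H z) => apply: (@ucontB _ _ _ dP F H)
    | |- ucont _ (fun z => @?F z + @?H z) => apply: (@ucontD _ _ _ F H)
    | |- ucont _ (fun z => @?F z * @?H z) => apply: (@ucontM _ _ _ dP F H)
    | |- ucont _ (fun z => @?F z ^+ ?n) => apply: (@ucontX _ _ _ dP F n)
    | |- ucont _ (fun z => dot (_ * _ * _)%g _) => exact: ucont_dot2
    | |- ucont _ (fun z => dot (_ * _)%g _) => exact: ucont_dot
    | |- ucont _ (fun z => dot _ _) => exact: ucont_dot1
    end ].

Lemma isE_dot1 i x : isE i (fun h => dot h x) (fun h => dot (h * qu i)%g x).
Proof.
have := isE_dot i 1%g x.
by congr isE; apply/funext => h; rewrite mulg1.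
Qed.

Lemma zonal_parts n i w w' x : isE i w w' -> zonal n w' x =
  - m (fun h => w h * (n%:R * dot h x ^+ n.-1 * dot (h * qu i)%g x)).
Proof.
move=> ww'; have [wu w'u _] := ww'.
have := isE_mul ww' (isE_exp n (isE_dot1 i x)).
move=> /isE_mean0; rewrite (meanD dP); last 2 first.
- exact: ucont_zonal_arg.
- by ucont_tac.
by move=> /eqP; rewrite addr_eq0 => /eqP.
Qed.

Lemma zonal_parts2 n i j w w' w'' x : isE i w w' -> isE j w' w'' ->
  zonal n w'' x = m (fun h => w h *
    (n%:R * (n.-1%:R * dot h x ^+ n.-2 * dot (h * qu i)%g x) *
      dot (h * qu j)%g x + n%:R * dot h x ^+ n.-1 * dot (h * qu i * qu j)%g x)).
Proof.
move=> ww' w'w''; rewrite (zonal_parts n x w'w''); have [wu w'u _] := ww'.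
have := isE_mul ww' (isE_mul (isE_scale n%:R (isE_exp n.-1 (isE_dot1 i x)))
  (isE_dot i (qu j) x)).
move=> /isE_mean0; rewrite (meanD dP); last 2 first.
- by ucont_tac.
- by ucont_tac.
by move=> /eqP; rewrite addr_eq0 => /eqP ->; rewrite opprK.
Qed.


(** Integration by parts moves both derivatives to the kernel, where the commutator is read off the
    multiplication table of the units. *)
Lemma zonal_bracket n i j (l : 'I_3) w w1 w2 w21 w12 wk x :
  isE i w w1 -> isE j w1 w12 -> isE j w w2 -> isE i w2 w21 -> isE l w wk ->
  (forall h, dot (h * qu i * qu j)%g x = dot (h * qu l)%g x) ->
  (forall h, dot (h * qu j * qu i)%g x = - dot (h * qu l)%g x) ->
  zonal n w12 x = zonal n w21 x - 2 * zonal n wk x.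
Proof.
move=> E1 E12 E2 E21 Ek ij ji.
rewrite (zonal_parts2 n x E1 E12) (zonal_parts2 n x E2 E21) (zonal_parts n x
  Ek).
have [wu _ _] := Ek.
rewrite mulrN opprK -(meanZ dP); last by ucont_tac.
rewrite -(meanD dP); [|by ucont_tac..].
by congr m; apply/funext => h; rewrite ij ji; ring.
Qed.

(** On the kernel, the units square to -1 and Parseval's identity eliminates the squared first
    derivatives. The truncated [n.-1] and [n.-2] matter only in terms whose coefficient n (n - 1) is
    then zero. *)
Lemma zonal_casimir n w w0 w1 w2 w00 w11 w22 x :
  isE 0 w w0 -> isE 1 w w1 -> isE 2%:R w w2 ->
  isE 0 w0 w00 -> isE 1 w1 w11 -> isE 2%:R w2 w22 ->
  zonal n w00 x + zonal n w11 x + zonal n w22 x =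
  n%:R * n.-1%:R * zonal n.-2 w x - n%:R * (n%:R + 2) * zonal n w x.
Proof.
move=> E0 E1 E2 E00 E11 E22; have [wu _ _] := E0.
rewrite (zonal_parts2 n x E0 E00) (zonal_parts2 n x E1 E11).
rewrite (zonal_parts2 n x E2 E22) -!(meanD dP); [|by ucont_tac..].
rewrite -!(meanZ dP) -?(meanB dP); [|by ucont_tac..].
congr m; apply/funext => h; rewrite !dot_qunit2.
have P := dot_parseval h x.
set s := dot h x in P *; set s0 := dot _ _ in P *; set s1 := dot _ _ in P *.
set s2 := dot _ _ in P *.
have P2 : s2 ^+ 2 = 1 - s ^+ 2 - s0 ^+ 2 - s1 ^+ 2 by rewrite -P; ring.
clearbody s s0 s1 s2.
case: n => [|[|n]] /=; first by ring.
  by ring.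
rewrite -!natr1 !exprS; ring: P2.
Qed.

Lemma isE_zero i : @isE R i (fun=> 0) (fun=> 0). Proof. exact: isE_cst. Qed.

Lemma zonal_one n x : zonal n (fun=> 1) x = m (fun h => dot h x ^+ n).
Proof. by congr m; apply/funext => h; rewrite mul1r. Qed.

Lemma zonal_zero n x : zonal n (fun=> 0) x = 0.
Proof.
rewrite -[RHS](mean_cst dP 0); congr m; apply/funext => h; exact: mul0r.
Qed.

Definition moment n x := m (fun h => dot h x ^+ n).

(** The Casimir relation for the constant function 1. *)
Lemma moment_rec n x :
  n%:R * n.-1%:R * moment n.-2 x = n%:R * (n%:R + 2) * moment n x.
Proof.
have := @zonal_casimir n _ _ _ _ _ _ _ x (isE_cst 0 1) (isE_cst 1 1)
  (isE_cst 2%:R 1) (isE_zero 0) (isE_zero 1) (isE_zero 2%:R).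
by rewrite !zonal_zero !zonal_one !addr0 => /esym/eqP; rewrite subr_eq0 => /eqP.
Qed.

Lemma moment0 x : moment 0 x = 1.
Proof. exact: (mean_cst dP 1). Qed.

Lemma momentSS n x : n.+1%:R * moment n x = (n%:R + 4) * moment n.+2 x.
Proof.
have := moment_rec n.+2 x; rewrite /= -!mulrA => /mulfI;
  rewrite pnatr_eq0 => ->//.
by congr (_ * _); rewrite -!natr1; ring.
Qed.

Lemma moment_odd n x : moment n.*2.+1 x = 0.
Proof.
elim: n => [|n IH].
  by have /esym/eqP := moment_rec 1 x; rewrite mulr0 mul0r mulf_eq0 mul1r;
    rewrite -[1%:R + 2]/(1 + 2) gt_eqF ?addr_gt0 //= => /eqP.
have /esym/eqP := momentSS n.*2.+1 x; rewrite IH mulr0 mulf_eq0 gt_eqF /=.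
  by rewrite doubleS => /eqP.
by rewrite ltr_wpDl // ler0n.
Qed.

Lemma moment_even_gt0 n x : 0 < moment n.*2 x.
Proof.
elim: n => [|n IH]; first by rewrite moment0.
have n4 : 0 < n.*2%:R + 4 :> R by rewrite ltr_wpDl // ler0n.
rewrite -(pmulr_rgt0 _ n4) doubleS -momentSS mulr_gt0 // ltr0n //.
Qed.

(* The kernels s^(2n) (1 + s) are nonnegative, and by the moment recursion they
   concentrate at s = 1 as n grows. *)
Lemma concentration f x : uc f -> 0 < f x ->
  exists n, 0 < zonal n.*2 f x + zonal n.*2.+1 f x.
Proof.
move=> fu fx; have [r r0 fr] := fu _ (divr_gt0 fx (@ltr0Sn R 1)).
have [B fB] := ucont_bounded dP fu.
pose e := f x / 2; have e0 : 0 < e by rewrite divr_gt0.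
pose M := (B + e) / r.
have B0 : 0 <= B by apply: le_trans (normr_ge0 _) (fB x).
have M0 : 0 < M by rewrite divr_gt0 //; lra.
(* A minorant affine in s = [dot h x]: close to x it is at most e, hence below f, and elsewhere M r
   = B + e brings it down to -B. *)
have f_ge h : e - M * (1 - dot h x) <= f h.
  have := dot_le1 h x; rewrite ler_norml => /andP[_ s1].
  have := fB h; rewrite ler_norml => /andP[fBh _].
  have [hx|hx] := ltP (dist h x) r.
    have := fr _ _ hx; rewrite ler_distl => /andP[fh _].
    have : 0 <= M * (1 - dot h x) by rewrite mulr_ge0 ?subr_ge0 // ltW.
    by rewrite /e; lra.
  have : M * r <= M * (1 - dot h x) by rewrite ler_wpM2l // ltW.
  by rewrite /M divfK ?gt_eqF //; lra.
(* Against s^(2n) (1 + s) the minorant has mean ((2n + 4) e - 3 M) / (2n + 4) times the moment of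
   order 2n; this n makes it positive. *)
pose n := Num.truncn (3 * M / e).
exists n; rewrite -(meanD dP); try exact: ucont_zonal_arg.
have s_ge0 h : 0 <= dot h x ^+ n.*2 * (1 + dot h x).
  rewrite mulr_ge0 //; first by rewrite -mul2n exprM exprn_ge0 ?sqr_ge0.
  by have := dot_le1 h x; rewrite ler_norml => /andP[]; lra.
apply: (@lt_le_trans _ _ (m (fun h => (e - M) * dot h x ^+ n.*2 +
    (e * dot h x ^+ n.*2.+1 + M * dot h x ^+ n.*2.+2)))); last first.
  apply: (ler_mean dP); [by ucont_tac..|] => h.
  have := ler_wpM2r (s_ge0 h) (f_ge h); rewrite !exprS.
  set z := dot h x ^+ n.*2; set s := dot h x => H.
  by apply: le_trans (le_trans _ H) _; rewrite le_eqVlt; apply/orP; left;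
    apply/eqP; ring.
rewrite (meanD dP) ?(meanD dP) ?(meanZ dP); [|by ucont_tac..].
rewrite -![m _]/(moment _ _) moment_odd mulr0 add0r.
have n4 : 0 < n.*2%:R + 4 :> R by rewrite ltr_wpDl // ler0n.
have mu0 := moment_even_gt0 n x.
rewrite -(pmulr_rgt0 _ n4) mulrDr (mulrCA _ M) -momentSS.
have := truncnS_gt (3 * M / e); rewrite -/n ltr_pdivrMr // => nM.
have -> : (n.*2%:R + 4) * ((e - M) * moment n.*2 x) +
   M * (n.*2.+1%:R * moment n.*2 x) =
   ((n.*2%:R + 4) * e - 3 * M) * moment n.*2 x by rewrite -natr1; ring.
rewrite mulr_gt0 // subr_gt0; apply: lt_le_trans nM _.
by rewrite ler_pM2r // -natr1 -mul2n natrM; have := ler0n R n; lra.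
Qed.

(** A nonzero value of f would give f^2 a positive mean against a kernel that is at most 2. *)
Lemma mean_sqr_eq0 f : uc f -> m (fun h => f h * f h) = 0 -> forall x, f x = 0.
Proof.
move=> fu f0 x; apply/eqP; apply: contraT => fx.
have ffu : uc (fun h => f h * f h) by ucont_tac.
have [|n] := @concentration _ x ffu; first by rewrite -expr2 exprn_even_gt0.
rewrite -(meanD dP); try exact: ucont_zonal_arg.
apply: contraTT => _; rewrite -leNgt -[0](mulr0 2) -f0 -(meanZ dP) //.
apply: (ler_mean dP); [by ucont_tac..|] => h.
rewrite -mulrDr mulrC ler_wpM2r ?mulr_self_ge0 //;
  first by rewrite -expr2 sqr_ge0.
have := dotX_le1 n.*2 h x; have := dotX_le1 n.*2.+1 h x.
by rewrite !ler_norml => /andP[_ ?] /andP[_ ?]; lra.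
Qed.

Lemma zonal_neq0 w x : uc w -> w x != 0 -> exists n, zonal n w x != 0.
Proof.
move=> wu wx; have wwu : uc (fun h => w x * w h) by ucont_tac.
have [|n] := @concentration _ x wwu; first by rewrite -expr2 exprn_even_gt0.
rewrite !zonalZ // -mulrDr => zn.
have [z0|] := eqVneq (zonal n.*2 w x) 0; last by exists n.*2.
exists n.*2.+1; apply: contraTneq zn => ->.
by rewrite z0 addr0 mulr0 ltxx.
Qed.

End ZonalKernel.

(** * Wirtinger's inequality for odd functions *)

Section OddFunctions.
Variable R : realType.
Local Notation G := (usphere R).
Local Notation uc := (ucont (@dist R)).
Local Notation m := (@mean R G).

Let dP := @dist_bimetric R.

Lemma versine_ge (e : R) : 0 < e -> exists2 dl, 0 < dl &
  forall t, 0 < t -> t < dl -> (1 - e) * t ^+ 2 <= 2 * (1 - cos t).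
Proof.
move=> e0; have e2 : 0 < e / 2 by rewrite divr_gt0.
have : \forall c \near (0 : R), `|cos 0 - cos c| < e / 2.
  by have /cvgrPdist_lt := @continuous_cos R 0; apply.
move=> /nbhs_ballP[dl /= dl0 dlr]; exists dl => // t t0 tdl.
have u0 : 0 < t / 2 by rewrite divr_gt0.
have [|c] := MVT_segment (ltW u0) (fun s _ => is_derive_sin s).
  by apply: continuous_subspaceT; exact: continuous_sin.
rewrite in_itv /= sin0 !subr0 => /andP[c0 ct] sE.
have cosc : 1 - e / 2 < cos c.
  have := dlr c; rewrite /ball /= sub0r normrN ger0_norm // cos0.
  by rewrite ltr_distlC => /(_ (le_lt_trans ct _)) H;
    have /andP[] := H ltac:(lra).
have -> : 1 - cos t = 2 * sin (t / 2) ^+ 2.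
  have {1}-> : t = t / 2 + t / 2 by lra.
  by rewrite cosD -!expr2 cos2sin2; ring.
rewrite sE exprMn -(mulr1 (1 - e)).
have -> : 2 * (2 * (cos c ^+ 2 * (t / 2) ^+ 2)) = cos c ^+ 2 * t ^+ 2 by field.
rewrite mulr1 ler_wpM2r ?sqr_ge0 //.
have [e1|e1] := leP 1 e; first by apply: le_trans (sqr_ge0 _); lra.
have : (1 - e / 2) ^+ 2 <= cos c ^+ 2 by rewrite ler_pXn2r ?nnegrE //; lra.
by apply: le_trans; nra.
Qed.

Let wirtinger_arith (t2 c p pt A e : R) : 0 < t2 -> 0 <= p ->
  t2 * A = 2 * p - 2 * pt -> pt <= c * p -> (1 - e) * t2 <= 2 * (1 - c) ->
  (1 - e) * p <= A.
Proof.
move=> t20 p0 E ptc ver; rewrite -(ler_pM2l t20) E.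
by have := ler_wpM2r p0 ver; lra.
Qed.

Let wirtinger_arith2 (p A B M e eta : R) : (1 - e) * p <= A ->
  A <= B + (2 * M + 1) * e -> 0 <= p -> 0 <= M -> 0 < e ->
  e * (2 * M + 2 + p) <= eta -> p <= eta + B.
Proof. by move=> *; lra. Qed.

(* The correlation [phi t] of an odd f with its translate is positive definite
   and antiperiodic with period pi, so it vanishes at pi / 2; halving the angle
   repeatedly gives [phi t <= cos t * phi 0] for arbitrarily small t. *)
Section Correlation.
Variables (i : 'I_3) (f f' : G -> R).
Hypothesis ff' : isE i f f'.
Hypothesis f_odd : forall x, f (qopp x) = - f x.
Let phi t := m (fun h => f h * f (h * qexp i t)%g).

Let fu : uc f. Proof. by case: ff'. Qed.
Let fut t : uc (fun h => f (h * qexp i t)%g).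
Proof. exact: (ucont_translr dP). Qed.
Let phiu t : uc (fun h => f h * f (h * qexp i t)%g).
Proof. exact: (ucontM dP). Qed.

Lemma correlation_shift s t :
  m (fun h => f (h * qexp i s)%g * f (h * qexp i t)%g) = phi (t - s).
Proof.
rewrite /phi -(mean_translr dP (qexp i s) (phiu (t - s))).
by congr m; apply/funext => h; rewrite -mulgA qexpD addrC subrK.
Qed.

Lemma correlation0 : phi 0 = m (fun h => f h * f h).
Proof. by congr m; apply/funext => h; rewrite qexp0 mulg1. Qed.

Lemma correlation_half_pi : phi (pi / 2) = 0.
Proof.
have e : phi (pi / 2) = - phi (pi / 2); last by lra.
have {1}-> : pi / 2 = 0 - - (pi / 2) :> R by lra.
rewrite -correlation_shift -(mulN1r (phi _)) -(meanZ dP) //; congr m.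
apply/funext => h; have -> : - (pi / 2) = pi / 2 - pi :> R by lra.
have -> : (h * qexp i (pi / 2))%g = qopp (h * qexp i (pi / 2 - pi))%g.
  by rewrite -(mul_qexp_pi i) -mulgA qexpD subrK.
by rewrite f_odd qexp0 mulg1 mulN1r mulrN opprK mulrC.
Qed.

Lemma correlation_le k :
  phi (pi / 2 ^+ k.+1) <= cos (pi / 2 ^+ k.+1) * phi 0.
Proof.
elim: k => [|k IH]; first by rewrite expr1 correlation_half_pi cos_pihalf mul0r.
pose t : R := pi / 2 ^+ k.+2.
have tE : pi / 2 ^+ k.+1 = t + t.
  by rewrite /t [in RHS]exprS; field; rewrite expf_neq0.
have t0 : 0 < t by rewrite divr_gt0 ?pi_gt0 ?exprn_gt0.
have cost : 0 < cos t.
  apply: cos_gt0_pihalf; rewrite (lt_trans _ t0) /=;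
    last by rewrite oppr_lt0 divr_gt0 ?pi_gt0.
  rewrite /t ltr_pM2l ?pi_gt0 // ltf_pV2 ?posrE ?exprn_gt0 //.
  by rewrite -[X in X < _]expr1 ltr_eXn2l // ltr1n.
rewrite -/t -(ler_pM2l cost); move: IH; rewrite tE cosD -!expr2 => IH.
(* Functions of frequency 1 satisfy f(0) + f(2t) = 2 cos t f(t), so this square loses nothing in the
   extremal case. *)
have pos : 0 <= m (fun h => (f h + f (h * qexp i (t + t))%g -
    2 * cos t * f (h * qexp i t)%g) ^+ 2).
  apply: (mean_ge0 dP) => [|h]; last exact: sqr_ge0.
  apply: (ucontX dP); apply: (ucontB dP); first exact: ucontD.
  by apply: (ucontM dP) => //; exact: ucont_cst.
suff E : m (fun h => (f h + f (h * qexp i (t + t))%g -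
    2 * cos t * f (h * qexp i t)%g) ^+ 2) =
  (2 + 4 * cos t ^+ 2) * phi 0 + (2 * phi (t + t) - 8 * cos t * phi t).
  rewrite {}E in pos; have := sin2cos2 t => sc; rewrite sc in IH; nra.
pose A := fun s u => (fun h => f (h * qexp i s)%g * f (h * qexp i u)%g).
have Au s u : uc (A s u) by exact: (ucontM dP).
have phiA s u : phi (u - s) = m (A s u) by rewrite -correlation_shift.
have -> : (2 + 4 * cos t ^+ 2) * phi 0 = m (A 0 0) + (m (A (t + t) (t + t)) +
    4 * cos t ^+ 2 * m (A t t)).
  by rewrite -!phiA !subrr; ring.
have -> : 2 * phi (t + t) - 8 * cos t * phi t =
    2 * m (A 0 (t + t)) + ((- 4 * cos t) * m (A 0 t) + (- 4 * cos t) * m (A t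
      (t + t))).
  by rewrite -!phiA !subr0 addrK; ring.
have Zu c g : uc g -> uc (fun h => c * g h).
  by move=> gu; apply: (ucontM dP) => //; exact: ucont_cst.
rewrite -!(meanZ dP) // -!(meanD dP) //;
  try by repeat (apply: ucontD || apply: Zu || exact: Au).
by congr m; apply/funext => h; rewrite /A qexp0 mulg1; ring.
Qed.

(** t^2 times the mean square of the difference quotient is 2 (phi 0 - phi t), at least 2 (1 - cos
    t) phi 0 along t = pi / 2^(k+1), and this is nearly t^2 phi 0 for small t. *)
Lemma odd_wirtinger : m (fun h => f h * f h) <= m (fun h => f' h * f' h).
Proof.
have f'u : uc f' by case: ff'.
have [M f'M] := ucont_bounded dP f'u.
have M0 : 0 <= M by apply: le_trans (normr_ge0 _) (f'M 1%g).
have p0 : 0 <= phi 0.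
  rewrite correlation0; apply: (mean_ge0 dP) => [|h]; first exact: (ucontM dP).
  by rewrite -expr2 sqr_ge0.
rewrite -correlation0; apply/ler_addgt0Pl => eta eta0.
(* C bounds the error per unit of e: 2 M + 1 from replacing the quotient by f', and phi 0 from the
   versine. *)
pose C := 2 * M + 2 + phi 0.
have C0 : 0 < C by rewrite /C; lra.
pose e := Num.min 1 (eta / C).
have e0 : 0 < e by rewrite lt_min ltr01 divr_gt0.
have e1 : e <= 1 by rewrite ge_min lexx.
have eC : e * C <= eta by rewrite -ler_pdivlMr // ge_min lexx orbT.
have [dl dl0 dle] := isE_unif ff' e0; have [dl' dl'0 dle'] := versine_ge e0.
pose d := Num.min dl dl'; have d0 : 0 < d by rewrite lt_min dl0.
pose k := Num.truncn (pi / d : R).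
pose t : R := pi / 2 ^+ k.+1.
have t0 : 0 < t by rewrite divr_gt0 ?pi_gt0 ?exprn_gt0.
have td : t < d.
  rewrite ltr_pdivrMr ?exprn_gt0 // mulrC -ltr_pdivrMr //.
  apply: (lt_le_trans (truncnS_gt _)); rewrite -/k -natrX ler_nat.
  exact/ltnW/ltn_expl.
have := td; rewrite lt_min => /andP[tdl tdl'].
have phit := correlation_le k; rewrite -/t in phit.
pose D h := (f (h * qexp i t)%g - f h) / t.
have Du : uc D by apply: (ucontM dP); [exact: (ucontB dP)|exact: ucont_cst].
have Dle : m (fun h => D h * D h) <= m (fun h => f' h * f' h) + (2 * M + 1) * e.
  rewrite -[X in _ + X](mean_cst dP) -(meanD dP);
    [|exact: (ucontM dP)|exact: ucont_cst].
  apply: (ler_mean dP) => [||h]; first exact: (ucontM dP).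
    by apply: ucontD; [exact: (ucontM dP)|exact: ucont_cst].
  have := dle t h; rewrite gt_eqF // gtr0_norm // => /(_ isT tdl).
  have := f'M h; rewrite -/(D h) ler_norml ler_distl => /andP[? ?] /andP[? ?].
  have [x xE] : {x | x = D h - f' h} by eexists.
  have -> : D h = f' h + x by rewrite xE; lra.
  have x1 : - e <= x <= e by apply/andP; split; lra.
  by case/andP: x1 => ? ?; nra.
have DE : t ^+ 2 * m (fun h => D h * D h) = 2 * phi 0 - 2 * phi t.
  rewrite -(meanZ dP); last exact: (ucontM dP).
  have -> : 2 * phi 0 = phi 0 + phi (t - t) by rewrite subrr; lra.
  rewrite -correlation_shift correlation0 -(meanZ dP) //.
  rewrite -(meanD dP); [|exact: (ucontM dP)..].
  rewrite -(meanB dP); last 2 first.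
  - by apply: ucontD; exact: (ucontM dP).
  - by apply: (ucontM dP) => //; exact: ucont_cst.
  by congr m; apply/funext => h; rewrite /D; field; rewrite gt_eqF.
have t2 : 0 < t ^+ 2 by rewrite exprn_gt0.
have := dle' t t0 tdl' => vers.
have low := wirtinger_arith t2 p0 DE phit vers.
exact: wirtinger_arith2 low Dle p0 M0 e0 eC.
Qed.

End Correlation.
End OddFunctions.

(** * Isotypic components *)

Section Jets.
Variable R : realType.
Local Notation G := (usphere R).
Local Notation m := (@mean R G).
Local Notation jets := (seq 'I_3 -> G -> R^o).
Implicit Types (J K : jets) (i j : 'I_3) (f g : G -> R).

Let dP := @dist_bimetric R.

(* [J [:: i1; ...; ik]] is the derivative E_i1 (... (E_ik f)) of f = J [::]. *)
Definition is_jet J := forall s i, isE i (J s) (J (i :: s)).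

(** The jet of E_i f: the derivation applied first stands last in the list. *)
Definition jshift i J : jets := fun s => J (rcons s i).

Lemma is_jet_shift i J : is_jet J -> is_jet (jshift i J).
Proof. by move=> Jj s j; apply: Jj. Qed.

Lemma is_jetD J K : is_jet J -> is_jet K -> is_jet (J + K).
Proof. by move=> Jj Kj s i; apply: isE_add. Qed.

Lemma is_jetZ c J : is_jet J -> is_jet (c *: J).
Proof. by move=> Jj s i; apply: isE_scale. Qed.

Lemma is_jet0 : is_jet 0.
Proof. by move=> s i; apply: isE_cst. Qed.

Lemma is_jetB J K : is_jet J -> is_jet K -> is_jet (J - K).
Proof. by move=> ? ?; rewrite -scaleN1r; apply/is_jetD/is_jetZ. Qed.

Lemma isE_unique i f f' g : isE i f f' -> isE i f g -> f' = g.
Proof.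
move=> [_ _ E1] [_ _ E2]; apply/funext => x.
by have [_ <-] := E1 x; have [_ <-] := E2 x.
Qed.

(** A total function, so that the field on [zonal_space] does not depend on a choice of jet for its
    argument. *)
Definition fieldD i f : G -> R :=
  fun x => 'D_1 (fun t : R => f (x * qexp i t)%g) 0.

Lemma isE_fieldD i f f' : isE i f f' -> fieldD i f = f'.
Proof. by move=> [_ _ E1]; apply/funext => x; apply: derive_val. Qed.

Lemma zonal_odd n w x : ucont (@dist R) w -> odd n ->
  zonal n w (qopp x) = - zonal n w x.
Proof.
move=> wu n_odd; rewrite -mulN1r -(meanZ dP); last exact: ucont_zonal_arg.
congr m; apply/funext => h.
by rewrite dot_opp exprNn -signr_odd n_odd expr1 !mulN1r mulrN.
Qed.

Lemma zonal_even n w x : ucont (@dist R) w -> (forall h, w (qopp h) = w h) ->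
  odd n -> zonal n w x = 0.
Proof.
move=> wu w_even n_odd; have : zonal n w (qopp x) = zonal n w x.
  have qoppE y : qopp y = (qopp 1 * y)%g by rewrite -qopp_mul mul1g.
  rewrite qoppE zonal_transl //; congr (zonal n _ x); apply/funext => h.
  by rewrite -qoppE.
by rewrite zonal_odd // => e; lra.
Qed.

(** The vanishing of the convolutions with smaller exponents is what makes the Casimir relation
    exact for the exponent n. *)
Definition good_jet n J := is_jet J /\
  forall k x, (k < n)%N -> zonal k (J [::]) x = 0.

Lemma good_jet_shift n i J : good_jet n J -> good_jet n (jshift i J).
Proof.
move=> [Jj J0]; split; first exact: is_jet_shift.
move=> k x kn; have : isE i (zonal k (J [::])) (zonal k (J [:: i])).
  exact/isE_zonal/Jj.
have -> : zonal k (J [::]) = fun=> 0 by apply/funext => y; apply: J0.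
by move/isE_unique/(_ (isE_cst i 0)) => /= ->.
Qed.

Lemma jet_ucont J s : is_jet J -> ucont (@dist R) (J s).
Proof. by move=> /(_ s 0)[]. Qed.

Lemma good_jet_lin n c J K :
  good_jet n J -> good_jet n K -> good_jet n (c *: J + K).
Proof.
move=> [Jj J0] [Kj K0]; split; first by apply: is_jetD => //; apply: is_jetZ.
move=> k x kn; rewrite [LHS](@zonalD _ _ (fun h => c * J [::] h)).
- by rewrite zonalZ ?J0 ?K0 ?mulr0 ?addr0 //; exact: jet_ucont.
- by apply: (ucontM dP); [exact: ucont_cst|exact: jet_ucont].
exact: jet_ucont.
Qed.

Lemma good_jet0 n : good_jet n 0.
Proof. by split; [exact: is_jet0|move=> k x _; exact: zonal_zero]. Qed.

Lemma good_jetD n J K : good_jet n J -> good_jet n K -> good_jet n (J + K).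
Proof. by move=> ? ?; rewrite -(scale1r J); apply: good_jet_lin. Qed.

Lemma good_jetZ n c J : good_jet n J -> good_jet n (c *: J).
Proof. by move=> ?; rewrite -[_ *: _]addr0; apply/good_jet_lin/good_jet0. Qed.

Lemma good_jetB n J K : good_jet n J -> good_jet n K -> good_jet n (J - K).
Proof. by move=> ? ?; rewrite -scaleN1r; apply/good_jetD/good_jetZ. Qed.

Section ZonalSpace.
Variable n : nat.

Definition zonal_pred : {pred G -> R^o} :=
  fun f => `[< exists2 J, good_jet n J & f = zonal n (J [::]) >].

(** The instance of the abstract module: a subspace of the functions on the sphere that is stable
    under the three fields. *)
Record zonal_space := ZonalSpace {
  zval : G -> R^o; _ : zval \in zonal_pred }.
HB.instance Definition _ := [isSub for zval].
HB.instance Definition _ := [Choice of zonal_space by <:].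

Lemma zonal_predP f : reflect (exists2 J, good_jet n J & f = zonal n (J [::]))
  (f \in zonal_pred).
Proof. exact: asboolP. Qed.

Lemma zonal_jet_lin c J K : good_jet n J -> good_jet n K ->
  zonal n ((c *: J + K) [::]) = c *: (zonal n (J [::]) : G -> R^o) + zonal n (K
    [::]).
Proof.
move=> [Jj _] [Kj _]; apply/funext => x.
rewrite [LHS](@zonalD _ _ (fun h => c * J [::] h)).
- by rewrite zonalZ //; exact: jet_ucont.
- by apply: (ucontM dP); [exact: ucont_cst|exact: jet_ucont].
exact: jet_ucont.
Qed.

Fact zonal_submod_closed : submod_closed zonal_pred.
Proof.
split.
  apply/zonal_predP; exists 0; first exact: good_jet0.
  by apply/funext => x; rewrite [RHS]zonal_zero.
move=> c f g /zonal_predP[J Jg ->] /zonal_predP[K Kg ->].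
apply/zonal_predP; exists (c *: J + K); first exact: good_jet_lin.
by rewrite zonal_jet_lin.
Qed.
HB.instance Definition _ := GRing.isSubmodClosed.Build _ _ zonal_pred
  zonal_submod_closed.
HB.instance Definition _ := [SubChoice_isSubLmodule of zonal_space by <:].

Lemma zvalP (f : zonal_space) :
  exists2 J, good_jet n J & zval f = zonal n (J [::]).
Proof. by apply/zonal_predP; apply: valP. Qed.

Fact fieldD_closed i (f : zonal_space) : fieldD i (zval f) \in zonal_pred.
Proof.
have [J Jg ->] := zvalP f; apply/zonal_predP; exists (jshift i J).
  exact: good_jet_shift.
by have [Jj _] := Jg; apply: isE_fieldD; apply: isE_zonal; apply: Jj.
Qed.

Definition zfield i (f : zonal_space) : zonal_space := ZonalSpace
  (fieldD_closed i f).

Lemma isE_zfield i (f : zonal_space) : isE i (zval f) (zval (zfield i f)).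
Proof.
rewrite /zfield /=; have [J [Jj _] ->] := zvalP f.
by have E1 := isE_zonal n (Jj [::] i); rewrite (isE_fieldD E1).
Qed.

Fact zfield_linear i : linear (zfield i).
Proof.
move=> c f g; apply: val_inj.
apply: (isE_unique (isE_zfield i (c *: f + g))).
apply: (isE_add (isE_scale c (isE_zfield i f)) (isE_zfield i g)).
Qed.
HB.instance Definition _ i := GRing.isLinear.Build R zonal_space zonal_space _
  (zfield i) (zfield_linear i).

Definition zform (f g : zonal_space) : R := m (fun x => zval f x * zval g x).

Lemma ucont_zval (f : zonal_space) : ucont (@dist R) (zval f).
Proof. by have [] := isE_zfield 0 f. Qed.

Lemma ucont_zvalM (f g : zonal_space) :
  ucont (@dist R) (fun x => zval f x * zval g x).
Proof. by apply: (ucontM dP); exact: ucont_zval. Qed.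

Lemma zformD (f g h : zonal_space) : zform (f + g) h = zform f h + zform g h.
Proof.
rewrite -(meanD dP); try exact: ucont_zvalM.
by congr m; apply/funext => x; rewrite -mulrDl.
Qed.

Lemma zformZ c (f h : zonal_space) : zform (c *: f) h = c * zform f h.
Proof.
rewrite -(meanZ dP); last exact: ucont_zvalM.
by congr m; apply/funext => x; rewrite mulrA.
Qed.

Lemma zformC (f g : zonal_space) : zform f g = zform g f.
Proof. by congr m; apply/funext => x; rewrite mulrC. Qed.

Lemma zform_ge0 (f : zonal_space) : 0 <= zform f f.
Proof.
by apply: (mean_ge0 dP) => [|x]; [exact: ucont_zvalM|rewrite -expr2 sqr_ge0].
Qed.

Lemma zform_eq0 (f : zonal_space) : zform f f = 0 -> f = 0.
Proof.
move=> f0; apply: val_inj; apply/funext => x.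
exact: mean_sqr_eq0 (ucont_zval f) f0 x.
Qed.

Lemma zform_skew i (f g : zonal_space) : zform (zfield i f) g = - zform f
  (zfield i g).
Proof.
have := isE_mul (isE_zfield i f) (isE_zfield i g) => /isE_mean0.
rewrite (meanD dP); try exact: ucont_zvalM.
by move=> /eqP; rewrite addr_eq0 => /eqP.
Qed.

Lemma zform_odd i (f : zonal_space) : odd n -> zform f f <= zform (zfield i f)
  (zfield i f).
Proof.
move=> n_odd; apply: (odd_wirtinger (isE_zfield i f)) => x.
by have [J [Jj _] ->] := zvalP f; apply: zonal_odd => //; apply: jet_ucont.
Qed.

Lemma zval_zfield2 i j (f : zonal_space) J : is_jet J -> zval f = zonal n (J
  [::]) ->
  zval (zfield i (zfield j f)) = zonal n (J [:: i; j]).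
Proof.
move=> Jj fE; have e1 : zval (zfield j f) = zonal n (J [:: j]).
  by rewrite /= fE; apply: isE_fieldD; apply: isE_zonal; apply: Jj.
apply: (isE_unique (isE_zfield i (zfield j f))); rewrite e1.
by apply: isE_zonal; apply: Jj.
Qed.

Lemma zval_zfield1 j (f : zonal_space) J : is_jet J -> zval f = zonal n (J
  [::]) ->
  zval (zfield j f) = zonal n (J [:: j]).
Proof.
by move=> Jj fE; rewrite /= fE; apply: isE_fieldD; apply: isE_zonal; apply: Jj.
Qed.

Lemma zfield_bracket i j (l : 'I_3) (f : zonal_space) :
  (forall x h, dot (h * qunit R i * qunit R j)%g x = dot (h * qunit R l)%g x) ->
  (forall x h, dot (h * qunit R j * qunit R i)%g x = - dot (h * qunit R l)%g x)
    ->
  zfield j (zfield i f) = zfield i (zfield j f) - 2 *: zfield l f.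
Proof.
move=> ij ji; have [J [Jj _] fE] := zvalP f.
apply: val_inj; apply/funext => x.
have -> : val (zfield i (zfield j f) - 2 *: zfield l f) x =
  zval (zfield i (zfield j f)) x - 2 * zval (zfield l f) x by [].
rewrite -[val]/zval !(zval_zfield2 _ _ Jj fE) (zval_zfield1 _ Jj fE).
exact: zonal_bracket (Jj _ _) (Jj _ _) (Jj _ _) (Jj _ _) (Jj _ _) (ij x) (ji x).
Qed.

Lemma zfield_casimir (f : zonal_space) : zfield 2%:R (zfield 2%:R f) =
  - (n%:R * (n%:R + 2)) *: f - zfield 0 (zfield 0 f) - zfield 1 (zfield 1 f).
Proof.
have [J [Jj J0] fE] := zvalP f; apply: val_inj; apply/funext => x.
have -> : val (- (n%:R * (n%:R + 2)) *: f - zfield 0 (zfield 0 f)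
    - zfield 1 (zfield 1 f)) x = - (n%:R * (n%:R + 2)) * zval f x -
  zval (zfield 0 (zfield 0 f)) x - zval (zfield 1 (zfield 1 f)) x by [].
rewrite -[val]/zval !(zval_zfield2 _ _ Jj fE) fE.
have := zonal_casimir n x (Jj _ _) (Jj _ _) (Jj _ _) (Jj [:: 0] 0)
  (Jj [:: 1] 1) (Jj [:: 2%:R] 2%:R).
(* For n >= 2 the exponent n - 2 is covered by goodness; for n < 2 the coefficient is zero. *)
have -> : n%:R * n.-1%:R * zonal n.-2 (J [::]) x = 0.
  have [n2|n2] := leqP 2 n; last by case: (n) n2 => [|[]] // _;
    rewrite ?mul0r ?mulr0 ?mul0r.
  by rewrite J0 ?mulr0 //; case: (n) n2 => [|[|k]].
by move=> ?; lra.
Qed.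

End ZonalSpace.
End Jets.

(** * From jets to the abstract eigenvalue bound *)

Section JetBound.
Variable R : realType.
Local Notation G := (usphere R).
Local Notation jets := (seq 'I_3 -> G -> R^o).
Implicit Types (J K L : jets) (i j : 'I_3).

Let dP := @dist_bimetric R.

(** The default 0 of [insubd] makes this total; it is never taken on good jets. *)
Definition zelt n J : zonal_space R n := insubd 0 (zonal n (J [::]) : G -> R^o).

Lemma zval_zelt n J : good_jet n J -> zval (zelt n J) = zonal n (J [::]).
Proof.
by move=> Jg; apply: insubdK; apply/zonal_predP; exists J.
Qed.

Lemma zelt_lin n c J K : good_jet n J -> good_jet n K ->
  zelt n (c *: J + K) = c *: zelt n J + zelt n K.
Proof.
move=> Jg Kg; apply: val_inj; rewrite [LHS]zval_zelt; last exact: good_jet_lin.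
rewrite zonal_jet_lin //.
by rewrite -(zval_zelt Jg) -(zval_zelt Kg).
Qed.

Lemma zelt0 n : zelt n 0 = 0.
Proof.
apply: val_inj; rewrite [LHS]zval_zelt; last exact: good_jet0.
by apply/funext => x; rewrite zonal_zero.
Qed.

Lemma zeltZ n c J : good_jet n J -> zelt n (c *: J) = c *: zelt n J.
Proof.
by move=> Jg; rewrite -[c *: J]addr0 zelt_lin ?zelt0 ?addr0 //;
  exact: good_jet0.
Qed.

Lemma zeltD n J K : good_jet n J -> good_jet n K ->
  zelt n (J + K) = zelt n J + zelt n K.
Proof. by move=> Jg Kg; rewrite -{1}(scale1r J) zelt_lin // scale1r. Qed.

Lemma zeltB n J K : good_jet n J -> good_jet n K ->
  zelt n (J - K) = zelt n J - zelt n K.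
Proof.
move=> Jg Kg; have NK := good_jetZ (-1) Kg.
by rewrite -scaleN1r zeltD // zeltZ // scaleN1r.
Qed.

Lemma zfield_zelt n i J : good_jet n J ->
  zfield i (zelt n J) = zelt n (jshift i J).
Proof.
move=> Jg; apply: val_inj; rewrite [RHS]zval_zelt; last exact: good_jet_shift.
by have [Jj _] := Jg; apply: (zval_zfield1 _ Jj); rewrite zval_zelt.
Qed.

Definition jcomb i j p q r J K L : jets :=
  p *: jshift i J - q *: jshift j K - r *: L.
Definition jdiv p q r J K L : jets :=
  p *: jshift 0 J + q *: jshift 1 K + r *: jshift 2%:R L.

Lemma good_jcomb n i j p q r J K L : good_jet n J -> good_jet n K ->
  good_jet n L -> good_jet n (jcomb i j p q r J K L).
Proof.
by move=> ? ? ?; rewrite /jcomb; do 2?[apply: good_jetB];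
  apply: good_jetZ => //;
  apply: good_jet_shift.
Qed.

Lemma good_jdiv n p q r J K L : good_jet n J -> good_jet n K ->
  good_jet n L -> good_jet n (jdiv p q r J K L).
Proof.
by move=> ? ? ?; rewrite /jdiv; do 2?[apply: good_jetD]; apply: good_jetZ => //;
  apply: good_jet_shift.
Qed.

Lemma zelt_jcomb n i j p q r J K L : good_jet n J -> good_jet n K ->
  good_jet n L -> zelt n (jcomb i j p q r J K L) =
    p *: zfield i (zelt n J) - q *: zfield j (zelt n K) - r *: zelt n L.
Proof.
move=> Jg Kg Lg; have Ji := good_jet_shift i Jg; have Kj := good_jet_shift j Kg.
have gp := good_jetZ p Ji; have gq := good_jetZ q Kj; have gr := good_jetZ r Lg.
rewrite (zfield_zelt i Jg) (zfield_zelt j Kg) /jcomb.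
rewrite (zeltB (good_jetB gp gq) gr) (zeltB gp gq).
by rewrite (zeltZ p Ji) (zeltZ q Kj) (zeltZ r Lg).
Qed.

Lemma zelt_jdiv n p q r J K L : good_jet n J -> good_jet n K ->
  good_jet n L -> zelt n (jdiv p q r J K L) =
    p *: zfield 0 (zelt n J) + q *: zfield 1 (zelt n K) +
    r *: zfield 2%:R (zelt n L).
Proof.
move=> Jg Kg Lg; have Ji := good_jet_shift 0 Jg; have Kj := good_jet_shift 1 Kg.
have Lk := good_jet_shift 2%:R Lg.
have gp := good_jetZ p Ji; have gq := good_jetZ q Kj; have gr := good_jetZ r Lk.
rewrite (zfield_zelt 0 Jg) (zfield_zelt 1 Kg) (zfield_zelt 2%:R Lg) /jdiv.
rewrite (zeltD (good_jetD gp gq) gr) (zeltD gp gq).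
by rewrite (zeltZ p Ji) (zeltZ q Kj) (zeltZ r Lk).
Qed.

Variables (a b c l : R).
Hypotheses (a_gt0 : 0 < a) (b_gt0 : 0 < b) (c_gt0 : 0 < c) (l_neq0 : l != 0).

Definition jcurl1 := jcomb 1 2%:R b c (2 * b * c / a).
Definition jcurl2 := jcomb 2%:R 0 c a (2 * a * c / b).
Definition jcurl3 := jcomb 0 1 a b (2 * a * b / c).

Theorem jet_eigenvalue_bound J1 J2 J3 :
  is_jet J1 -> is_jet J2 -> is_jet J3 ->
  let P1 := jcurl1 J3 J2 J1 in let P2 := jcurl2 J1 J3 J2 in
  let P3 := jcurl3 J2 J1 J3 in let D := jdiv a b c J1 J2 J3 in
  (forall x, (jcurl1 P3 P2 P1 - a *: jshift 0 D) [::] x = l * J1 [::] x) ->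
  (forall x, (jcurl2 P1 P3 P2 - b *: jshift 1 D) [::] x = l * J2 [::] x) ->
  (forall x, (jcurl3 P2 P1 P3 - c *: jshift 2%:R D) [::] x = l * J3 [::] x) ->
  (exists x, [|| J1 [::] x != 0, J2 [::] x != 0 | J3 [::] x != 0]) ->
  [\/ 4 * b ^+ 2 * c ^+ 2 / a ^+ 2 <= l, 4 * a ^+ 2 * c ^+ 2 / b ^+ 2 <= l
    | 4 * a ^+ 2 * b ^+ 2 / c ^+ 2 <= l] \/
  (a ^+ 2 + b ^+ 2 + c ^+ 2 <= l /\ ~ forall h, [/\ J1 [::] (qopp h) = J1 [::]
    h,
    J2 [::] (qopp h) = J2 [::] h & J3 [::] (qopp h) = J3 [::] h]).
Proof.
move=> jet1 jet2 jet3 P1 P2 P3 D e1 e2 e3 [x0 J_neq0].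
have u1 := jet_ucont [::] jet1; have u2 := jet_ucont [::] jet2.
have u3 := jet_ucont [::] jet3.
pose nz n := `[< exists x, [|| zonal n (J1 [::]) x != 0, zonal n (J2 [::]) x !=
  0
  | zonal n (J3 [::]) x != 0] >].
have ex_nz : exists n, nz n.
  case/or3P: J_neq0 => Jx.
  - by have [n zn] := zonal_neq0 u1 Jx; exists n; apply/asboolP; exists x0;
      rewrite zn.
  - by have [n zn] := zonal_neq0 u2 Jx; exists n; apply/asboolP; exists x0;
      rewrite zn orbT.
  by have [n zn] := zonal_neq0 u3 Jx; exists n; apply/asboolP; exists x0;
    rewrite zn !orbT.
case: (ex_minnP ex_nz) => n /asboolP[x zx] n_min.
have small k y : (k < n)%N -> [/\ zonal k (J1 [::]) y = 0,
    zonal k (J2 [::]) y = 0 & zonal k (J3 [::]) y = 0].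
  move=> kn; have /asboolP/forallNP/(_ y)/negP : ~~ nz k.
    by apply: contraTN kn => /n_min; rewrite -leqNgt.
  by rewrite !negb_or !negbK => /and3P[/eqP ? /eqP ? /eqP ?].
have g1 : good_jet n J1 by split=> // k y /small-/(_ y)[].
have g2 : good_jet n J2 by split=> // k y /small-/(_ y)[].
have g3 : good_jet n J3 by split=> // k y /small-/(_ y)[].
have gP1 : good_jet n P1 by exact: good_jcomb.
have gP2 : good_jet n P2 by exact: good_jcomb.
have gP3 : good_jet n P3 by exact: good_jcomb.
have gD : good_jet n D by exact: good_jdiv.
have eqn i p (N J : jets) : good_jet n N -> good_jet n J ->
    (forall x, (N - p *: jshift i D) [::] x = l * J [::] x) ->
    zelt n N - p *: zfield i (zelt n D) = l *: zelt n J.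
  move=> gN gJ e; have gDi := good_jet_shift i gD.
  rewrite (zfield_zelt i gD) -(zeltZ p gDi) -(zeltB gN (good_jetZ p gDi)).
  rewrite -(zeltZ l gJ); congr (insubd 0 (zonal n _)).
  by apply/funext => y; rewrite e.
have E1 := eqn _ _ _ _ (good_jcomb _ _ _ _ _ gP3 gP2 gP1) g1 e1.
have E2 := eqn _ _ _ _ (good_jcomb _ _ _ _ _ gP1 gP3 gP2) g2 e2.
have E3 := eqn _ _ _ _ (good_jcomb _ _ _ _ _ gP2 gP1 gP3) g3 e3.
rewrite !zelt_jcomb // in E1 E2 E3; rewrite zelt_jdiv // in E1 E2 E3.
have u_neq0 : ~ [/\ zelt n J1 = 0, zelt n J2 = 0 & zelt n J3 = 0].
  move=> [z1 z2 z3]; move: zx; rewrite -!zval_zelt // z1 z2 z3.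
  by rewrite !eqxx.
case: (@hodge_eigenvalue_bound _ (zonal_space R n) (zfield 0) (zfield 1)
  (zfield 2%:R) (@zform R n) n (@zformD R n) (@zformZ R n) (@zformC R n)
  (@zform_ge0 R n) (@zform_eq0 R n) (@zform_skew R n 0) (@zform_skew R n 1)
  (@zform_skew R n 2%:R) _ _ _ (@zfield_casimir R n)
  (fun o f => @zform_odd R n 0 f o) (fun o f => @zform_odd R n 1 f o)
  (fun o f => @zform_odd R n 2%:R f o) a b c a_gt0 b_gt0 c_gt0
  (zelt n J1) (zelt n J2) (zelt n J3) l l_neq0 u_neq0 E1 E2 E3).
- by move=> f; apply: zfield_bracket => y h; rewrite dot_qunit01.
- move=> f; apply/eqP; rewrite -subr_eq; apply/eqP/esym.
  by apply: zfield_bracket => y h; rewrite dot_qunit20.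
- by move=> f; apply: zfield_bracket => y h; rewrite dot_qunit12.
- by left.
(* An odd kernel convolves even components to zero, against the choice of n. *)
move=> [n_odd le_l]; right; split=> // J_even; move: zx.
have ev1 h : J1 [::] (qopp h) = J1 [::] h by case: (J_even h).
have ev2 h : J2 [::] (qopp h) = J2 [::] h by case: (J_even h).
have ev3 h : J3 [::] (qopp h) = J3 [::] h by case: (J_even h).
by rewrite !zonal_even // !eqxx.
Qed.

End JetBound.

(** * Quaternions as matrices *)

Section Topology.
Variable R : realType.

Lemma continuous_mx (S T : topologicalType) m n (f : S -> 'M[T]_(m, n)) :
  (forall i j, continuous (fun x => f x i j)) -> continuous f.
Proof.
move=> fc x A [P MP sPA].
have : \forall y \near x, forall ij : 'I_m * 'I_n, P ij.1 ij.2 (f y ij.1 ij.2).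
  by apply: filter_forall => -[i j] /=; apply: (fc i j x); apply: MP.
by apply: filterS => y Py; apply: sPA => i j; apply: (Py (i, j)).
Qed.

Lemma continuous_complex (T : topologicalType) (f g : T -> R) :
  continuous f -> continuous g ->
  continuous (fun x => (f x +i* g x)%C : (R[i] : numFieldType)).
Proof.
move=> fc gc x; apply/(@cvgrPdist_lt (R[i] : numFieldType)) => e e0.
case: e e0 => r s; rewrite ltcE /= => /andP[/eqP -> r0].
have r2 : 0 < r / 2 by rewrite divr_gt0.
have /(@cvgrPdist_lt R)/(_ _ r2) fx := fc x.
have /(@cvgrPdist_lt R)/(_ _ r2) gx := gc x.
near=> y; rewrite normc_def /= ltcE /= eqxx /=.
have fy : `|f x - f y| < r / 2 by near: y.
have gy : `|g x - g y| < r / 2 by near: y.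
rewrite -(ger0_norm (ltW r0)) -sqrtr_sqr ltr_sqrt ?exprn_gt0 //.
move: fy gy; rewrite !ltr_norml => /andP[? ?] /andP[? ?]; nra.
Unshelve. all: by end_near.
Qed.

Lemma continuous_Re : continuous (fun z : (R[i] : numFieldType) => complex.Re
  z).
Proof.
move=> z A /nbhs_ballP[e /= e0 eA].
have e0' : 0 < (e%:C)%C :> R[i] by rewrite ltcE /= eqxx.
apply/(@nbhs_ballP (R[i] : numFieldType)); exists (e%:C)%C => // w zw.
apply: eA; move: zw; rewrite /ball /= normc_def ltcE /= eqxx /=.
apply: le_lt_trans.
have -> : complex.Re z - complex.Re w = complex.Re (z - w) by case: (z) (w) =>
  ? ? [].
by rewrite -sqrtr_sqr ler_wsqrtr // lerDl sqr_ge0.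
Qed.

Lemma sum2 (V : nmodType) (F : 'I_2 -> V) : \sum_i F i = F 0 + F 1.
Proof. by rewrite !big_ord_recl big_ord0 addr0; congr (_ + F _);
  apply: val_inj. Qed.

Lemma continuous_ReM (T : topologicalType)
    (f : T -> 'M[R[i] : numFieldType]_2) (X : 'M[R[i]]_2) :
  (forall r s, continuous (fun x => f x r s)) ->
  continuous (fun x => complex.Re (\tr (f x *m X))).
Proof.
move=> fc x; pose g x := \tr (f x *m X) : (R[i] : numFieldType).
have gc : {for x, continuous g}.
  have -> : g = fun y => f y 0 0 * X 0 0 + f y 0 1 * X 1 0 +
      (f y 1 0 * X 0 1 + f y 1 1 * X 1 1).
    by apply/funext => y; rewrite /g /mxtrace !sum2 !mxE !sum2.
  by do 2?[apply: (@cvgD (R[i] : numFieldType))];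
    (apply: (@cvgM (R[i] : numFieldType)); [exact: fc|exact: cvg_cst]).
exact: (continuous_comp gc (@continuous_Re (g x))).
Qed.

Lemma continuous_Re_mx (X : 'M[R[i]]_2) :
  continuous (fun u : 'M[R[i] : numFieldType]_2 => complex.Re (\tr (u *m X))).
Proof.
apply: (continuous_ReM (f := id)) => r s.
exact: (@coord_continuous (R[i] : numFieldType)).
Qed.

End Topology.

Section QuaternionMatrices.
Variable R : realType.
Local Notation quat := (R * R * R * R)%type.
Implicit Types x y : quat.

Lemma sum3 (V : nmodType) (F : 'I_3 -> V) : \sum_i F i = F 0 + F 1 + F 2%:R.
Proof.
rewrite !big_ord_recl big_ord0 addr0 addrA.
by congr (_ + F _ + F _); apply: val_inj.
Qed.

Lemma ord3P (P : 'I_3 -> Prop) : P 0 -> P 1 -> P 2%:R -> forall i, P i.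
Proof.
move=> P0 P1 P2 [[|[|[|//]]] ?].
- by rewrite (_ : Ordinal _ = 0) //; apply: val_inj.
- by rewrite (_ : Ordinal _ = 1) //; apply: val_inj.
by rewrite (_ : Ordinal _ = 2%:R) //; apply: val_inj.
Qed.

Lemma ord3_natE : (nat_of_ord (0 : 'I_3) = 0%N) * (nat_of_ord (1 : 'I_3) = 1%N)
  *
  (nat_of_ord (2%:R : 'I_3) = 2%N).
Proof. by []. Qed.

Lemma ord2P (P : 'I_2 -> Prop) : P 0 -> P 1 -> forall i, P i.
Proof.
move=> P0 P1 [[|[|//]] ?].
- by rewrite (_ : Ordinal _ = 0) //; apply: val_inj.
by rewrite (_ : Ordinal _ = 1) //; apply: val_inj.
Qed.

Lemma mx2P (T : Type) (A B : 'M[T]_2) : A 0 0 = B 0 0 -> A 0 1 = B 0 1 ->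
  A 1 0 = B 1 0 -> A 1 1 = B 1 1 -> A = B.
Proof. by move=> *; apply/matrixP; apply: ord2P; apply: ord2P. Qed.

(** The standard embedding of the quaternions into complex matrices; it sends the units to E_1, E_2,
    E_3. *)
Definition qmx x : 'M[R[i]]_2 := let: (x0, x1, x2, x3) := x in
  \matrix_(r, s) if r == 0 then if s == 0 then (x0 +i* x1)%C else (x2 +i* x3)%C
    else if s == 0 then (- x2 +i* x3)%C else (x0 -i* x1)%C.

Definition qcoord (i : 'I_3) x : R :=
  match val i with 0%N => x.1.1.2 | 1%N => x.1.2 | _ => x.2 end.

Lemma qmxM x y : qmx x *m qmx y = qmx (qmul x y).
Proof.
move: x y => [[[? ?] ?] ?] [[[? ?] ?] ?].
by apply: mx2P; rewrite !mxE !sum2 !mxE /=; congr (_ +i* _)%C; rewrite /=; ring.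
Qed.

Lemma qmxB x y : qmx x - qmx y = qmx (x - y).
Proof.
move: x y => [[[? ?] ?] ?] [[[? ?] ?] ?].
by apply: mx2P; rewrite !mxE /=; congr (_ +i* _)%C; rewrite /=; ring.
Qed.

Lemma qmxZ (k : R) x : (k%:C)%C *: qmx x =
  qmx (k * x.1.1.1, k * x.1.1.2, k * x.1.2, k * x.2).
Proof.
move: x => [[[? ?] ?] ?].
by apply: mx2P; rewrite !mxE /=; congr (_ +i* _)%C; rewrite /=; ring.
Qed.

Lemma E_qmx i : E R i = qmx (qvec i 0 1).
Proof.
by move: i; apply: ord3P; apply: mx2P; rewrite !mxE //=; congr (_ +i* _)%C;
  rewrite ?oppr0.
Qed.

Lemma expE_qmx i t : expE i t = qmx (qexp i t).
Proof.
rewrite /expE E_qmx qmxZ; move: i; apply: ord3P; apply: mx2P;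
  by rewrite !mxE /=; congr (_ +i* _)%C; rewrite /=; ring.
Qed.

Lemma tr_qmx x : \tr (qmx x) = ((2 * x.1.1.1)%:C)%C.
Proof.
move: x => [[[? ?] ?] ?]; rewrite /mxtrace sum2 !mxE /=.
by congr (_ +i* _)%C; rewrite /=; ring.
Qed.

Lemma coordE_qmx i x : coordE i (qmx x) = qcoord i x.
Proof.
rewrite /coordE E_qmx qmxM tr_qmx; move: x i => [[[x0 x1] x2] x3].
have h (r : R) : complex.Re (- (r%:C)%C / 2 : R[i]) = - r / 2.
  have -> : - (r%:C)%C / 2 = ((- r / 2)%:C)%C :> R[i].
    by rewrite rmorphM rmorphN fmorphV rmorph_nat.
  by [].
by apply: ord3P; rewrite h /qcoord /=; field.
Qed.

Lemma det_qmx x : \det (qmx x) = ((qdot x x)%:C)%C.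
Proof.
rewrite (expand_det_row _ 0) sum2 /cofactor !det_mx11 !mxE /=.
move: x => [[[? ?] ?] ?]; rewrite !mxE /= /qdot /=.
by rewrite !expr0 !expr1; congr (_ +i* _)%C; rewrite /=; ring.
Qed.

Lemma qmx1 : qmx (1, 0, 0, 0) = 1%:M.
Proof. by apply: mx2P; rewrite !mxE //=; congr (_ +i* _)%C; rewrite ?oppr0. Qed.

Lemma qmx_conj x : ((qmx x)^T ^ Num.conj)%sesqui = qmx (qconj x).
Proof.
by move: x => [[[? ?] ?] ?]; apply: mx2P; rewrite !mxE /=; congr (_ +i* _)%C;
  rewrite ?opprK.
Qed.

Lemma qmul_conj x : qdot x x = 1 -> qmul x (qconj x) = (1, 0, 0, 0).
Proof.
move: x => [[[? ?] ?] ?]; rewrite /qdot /= => h.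
by congr (_, _, _, _); try ring; rewrite -h; ring.
Qed.

Lemma qmx_unitary x : qdot x x = 1 -> qmx x \is unitarymx.
Proof. by move=> x1; apply/unitarymxP;
  rewrite qmx_conj qmxM qmul_conj ?qmx1. Qed.

Lemma invmx_qmx x : qdot x x = 1 -> invmx (qmx x) = qmx (qconj x).
Proof.
move=> x1; have xc : qmx x *m qmx (qconj x) = 1%:M by rewrite qmxM qmul_conj
  ?qmx1.
have [u _] := mulmx1_unit xc.
by rewrite -[LHS]mulmx1 -xc mulmxA mulVmx // mul1mx.
Qed.

(** The double cover of SO(3), written as a polynomial map on all quaternions so that its continuity
    needs no restriction to the sphere. *)
Definition rot x : 'M[R]_3 :=
  \matrix_(i, j) qcoord i (qmul (qmul x (qvec j 0 1)) (qconj x)).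

Lemma Ad_qmx x : qdot x x = 1 -> Ad (qmx x) = rot x.
Proof.
move=> x1; apply/matrixP => i j.
by rewrite !mxE E_qmx invmx_qmx // !qmxM coordE_qmx.
Qed.

Lemma rotM x y : rot x *m rot y = rot (qmul x y).
Proof.
apply/matrixP; apply: ord3P; apply: ord3P; rewrite !mxE !sum3 !mxE;
  by move: x y => [[[? ?] ?] ?] [[[? ?] ?] ?]; rewrite /qcoord /=; ring.
Qed.

Lemma rot_tr x : (rot x)^T = rot (qconj x).
Proof.
apply/matrixP; apply: ord3P; apply: ord3P; rewrite !mxE;
  by move: x => [[[? ?] ?] ?]; rewrite /qcoord /=; ring.
Qed.

Lemma rot1 : rot (1, 0, 0, 0) = 1%:M.
Proof.
apply/matrixP; apply: ord3P; apply: ord3P; rewrite !mxE /qcoord /=; ring.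
Qed.

Lemma rot_orthogonal x : qdot x x = 1 -> rot x *m (rot x)^T = 1%:M.
Proof. by move=> x1; rewrite rot_tr rotM qmul_conj ?rot1. Qed.

Lemma rot_neg x : rot (qneg x) = rot x.
Proof.
apply/matrixP; apply: ord3P; apply: ord3P; rewrite !mxE;
  by move: x => [[[? ?] ?] ?]; rewrite /qcoord /=; ring.
Qed.

Lemma det3 (A : 'M[R]_3) : \det A =
  A 0 0 * (A 1 1 * A 2%:R 2%:R - A 1 2%:R * A 2%:R 1)
  - A 0 1 * (A 1 0 * A 2%:R 2%:R - A 1 2%:R * A 2%:R 0)
  + A 0 2%:R * (A 1 0 * A 2%:R 1 - A 1 1 * A 2%:R 0).
Proof.
rewrite (expand_det_row _ 0) sum3 /cofactor.
have det2 (B : 'M[R]_2) : \det B = B 0 0 * B 1 1 - B 0 1 * B 1 0.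
  rewrite (expand_det_row _ 0) sum2 /cofactor !det_mx11 !mxE.
  rewrite (_ : lift 0 0 = 1); last exact: val_inj.
  rewrite (_ : lift 1 0 = 0); last exact: val_inj.
  by rewrite expr0 expr1; ring.
rewrite !det2 !mxE.
have -> : lift (0 : 'I_3) (0 : 'I_2) = 1 by exact: val_inj.
have -> : lift (0 : 'I_3) (1 : 'I_2) = 2%:R by exact: val_inj.
have -> : lift (1 : 'I_3) (0 : 'I_2) = 0 by exact: val_inj.
have -> : lift (1 : 'I_3) (1 : 'I_2) = 2%:R by exact: val_inj.
have -> : lift (2%:R : 'I_3) (0 : 'I_2) = 0 by exact: val_inj.
have -> : lift (2%:R : 'I_3) (1 : 'I_2) = 1 by exact: val_inj.
by rewrite /=; ring.
Qed.

Lemma det_rot x : qdot x x = 1 -> \det (rot x) = 1.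
Proof.
move=> x1; have -> : \det (rot x) = qdot x x ^+ 3; last by rewrite x1 expr1n.
rewrite det3 !mxE; move: x {x1} => [[[? ?] ?] ?].
by rewrite /qcoord /qdot /=; ring.
Qed.

Variables a b c : R.

Lemma frame_qmx i : frame a b c i = qmx (qvec i 0 (abc a b c i)).
Proof.
rewrite /frame E_qmx qmxZ; congr qmx; move: i.
by apply: ord3P; rewrite /qvec /=; congr (_, _, _, _); ring.
Qed.

Lemma frame_sconstE i j k : frame_sconst a b c i j k =
  2 * eps R i j k * abc a b c i * abc a b c j / abc a b c k.
Proof.
rewrite /frame_sconst !frame_qmx !qmxM qmxB coordE_qmx; congr (_ / _).
move: i j k; apply: ord3P; apply: ord3P; apply: ord3P;
  by rewrite /eps ?ord3_natE /qcoord /abc /=; field.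
Qed.

End QuaternionMatrices.

(** * Pulling forms back to the 3-sphere *)

Lemma is_derive_mull (R : realType) (k : R) : is_derive (0 : R) (1 : R) (fun t
  => k * t) k.
Proof.
by have := is_deriveZ k (is_derive_id (0 : R) 1);
  rewrite -[k *: 1]/(k * 1) mulr1.
Qed.

Section Smooth.
Variables (R : realType) (M : framed_group R).

Lemma smooth_fder i (f : form0 M) : smooth f -> smooth (fder i f).
Proof. by move=> fs k; have [_ [_ /(_ i)]] := fs k.+1. Qed.

Lemma star1E (w : form1 M) g : [/\ star1 w 1 2%:R g = w 0 g,
  star1 w 2%:R 0 g = w 1 g & star1 w 0 1 g = w 2%:R g].
Proof.
by split; rewrite /star1 sum3 /eps ?ord3_natE; field.
Qed.


Variables (a b c : R).
Hypotheses (a_gt0 : 0 < a) (b_gt0 : 0 < b) (c_gt0 : 0 < c).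
Hypothesis sconstM : sconst M = frame_sconst a b c.

(** The structure constants drop out: the bracket of two frame fields is a multiple of the third,
    e_z, and a 2-form vanishes on (e_z, e_z). *)
Lemma delta1E (w : form1 M) g : delta1 w g =
  - (fder 0 (w 0) g + fder 1 (w 1) g + fder 2%:R (w 2%:R) g).
Proof.
have s0 : abc a b c 0 = a by [].
have s1 : abc a b c 1 = b by [].
have s2 : abc a b c 2%:R = c by [].
rewrite /delta1 /star3 /d2.
have -> : star1 w 1 2%:R = w 0 by apply/funext => h; have [] := star1E w h.
have -> : star1 w 2%:R 0 = w 1 by apply/funext => h; have [] := star1E w h.
have -> : star1 w 0 1 = w 2%:R by apply/funext => h; have [] := star1E w h.
rewrite !sum3 sconstM !frame_sconstE s0 s1 s2 /star1 !sum3 /eps !ord3_natE.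
by field; rewrite !gt_eqF.
Qed.

Lemma curlE (w : form1 M) g : [/\
  star2 (d1 w) 0 g = fder 1 (w 2%:R) g - fder 2%:R (w 1) g
    - 2 * b * c / a * w 0 g,
  star2 (d1 w) 1 g = fder 2%:R (w 0) g - fder 0 (w 2%:R) g
    - 2 * a * c / b * w 1 g
& star2 (d1 w) 2%:R g = fder 0 (w 1) g - fder 1 (w 0) g
    - 2 * a * b / c * w 2%:R g].
Proof.
have s0 : abc a b c 0 = a by [].
have s1 : abc a b c 1 = b by [].
have s2 : abc a b c 2%:R = c by [].
rewrite /star2 !sum3 /d1 !sum3 sconstM !frame_sconstE s0 s1 s2 /eps !ord3_natE.
have a0 : a != 0 by rewrite gt_eqF.
have b0 : b != 0 by rewrite gt_eqF.
have c0 : c != 0 by rewrite gt_eqF.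
by split; field; rewrite ?a0 ?b0 ?c0.
Qed.

End Smooth.

Section Pullback.
Variables (R : realType) (a b c : R).
Hypotheses (a_gt0 : 0 < a) (b_gt0 : 0 < b) (c_gt0 : 0 < c).
Variable M : framed_group R.
Local Notation G := (usphere R).
Local Notation quat := (R * R * R * R)%type.
Local Notation jets := (seq 'I_3 -> G -> R^o).
Local Notation s := (abc a b c).
(** The flows are right multiplications and commute with left translations, so [phi] can be made to
    pass through any chosen point of the group. *)
Variable phi : quat -> ambient M.
Hypothesis sconstM : sconst M = frame_sconst a b c.
Hypothesis phi_continuous : continuous phi.
Hypothesis phi_carrier : forall x : G, carrier M (phi x).
Hypothesis phi_flow : forall i t (x : G),
  flow M i t (phi x) = phi (x * qexp i (s i * t))%g.

Lemma abc_gt0 i : 0 < s i.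
Proof. by move: i; apply: ord3P. Qed.

Let pull (f : form0 M) : G -> R := fun x => f (phi x).

Lemma pull_ucont f : {within carrier M, continuous f} ->
  ucont (@dist R) (pull f).
Proof.
move=> /subspace_continuousP fc.
apply: (@continuous_ucont R (fun x => f (phi x))).
apply/subspace_continuousP => x xS.
have xS' : qdot x x == 1 by apply/eqP.
have px : carrier M (phi x) := phi_carrier (Usphere xS').
apply: (@cvg_comp _ _ _ phi f _ (within (carrier M) (nbhs (phi x))));
  last exact: fc.
move=> A AP.
have {}AP : nbhs (phi x) [set y | carrier M y -> A y] := AP.
have pA : nbhs x (phi @^-1` [set y | carrier M y -> A y]) := phi_continuous AP.
change (nbhs x [set y | qsphere y -> A (phi y)]).
apply: filterS pA => y Ay yS; apply: Ay.
have yS' : qdot y y == 1 by apply/eqP.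
exact: (phi_carrier (Usphere yS')).
Qed.

Lemma isE_pull i f : smooth f ->
  isE i (pull f) (fun x => (s i)^-1 * pull (fder i f) x).
Proof.
move=> fs; have [fc [fd _]] := fs 1%N; have [f'c _] := smooth_fder i fs 0%N.
split; first exact: pull_ucont.
  by apply: (ucontM (@dist_bimetric R)); [exact: ucont_cst|exact: pull_ucont].
move=> x; have si : s i != 0 by rewrite gt_eqF // abc_gt0.
have -> : (fun t => pull f (x * qexp i t)%g) =
    (fun t => f (flow M i t (phi x))) \o (fun t => (s i)^-1 * t).
  by apply/funext => t /=; rewrite phi_flow mulrA divff // mul1r.
rewrite mulrC; apply: is_derive1_comp.
  by rewrite mulr0 /pull /fder derive1E; apply/derivableP/fd/phi_carrier.
exact: is_derive_mull.
Qed.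

Lemma fder_pull i f f' (x : G) : isE i (pull f) f' -> fder i f (phi x) = s i *
  f' x.
Proof.
move=> [_ _ /(_ x) fd]; rewrite /fder derive1E.
have -> : (fun t => f (flow M i t (phi x))) =
    (fun t => pull f (x * qexp i t)%g) \o (fun t => s i * t).
  by apply/funext => t /=; rewrite phi_flow.
apply: derive_val; rewrite mulrC; apply: is_derive1_comp;
  first by rewrite mulr0.
exact: is_derive_mull.
Qed.

(** The frame field e_i corresponds to s_i E_i on the sphere, whence one factor 1 / s_i per
    derivation. *)
Definition pull_jet (f : form0 M) : jets := fun r x =>
  (\prod_(i <- r) (s i)^-1) * foldr (fun i h => fder i h) f r (phi x).

Lemma is_jet_pull f : smooth f -> is_jet (pull_jet f).
Proof.
move=> fs r i; have rs : smooth (foldr (fun i h => fder i h) f r).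
  by elim: r => //= j r IH; apply: smooth_fder.
have := isE_scale (\prod_(i <- r) (s i)^-1) (isE_pull i rs).
by congr isE; apply/funext => x; rewrite /pull_jet big_cons /= mulrCA mulrA.
Qed.

Lemma pull_jet0 f (x : G) : pull_jet f [::] x = f (phi x).
Proof. by rewrite /pull_jet big_nil mul1r. Qed.

(** Only values on the image of [phi] are compared; the flows preserve this image, so the relation
    is stable under the curl and can be applied twice to reach [delta2 (d1 w)]. *)
Definition rep (w : form1 M) (J1 J2 J3 : jets) :=
  [/\ is_jet J1, is_jet J2 & is_jet J3] /\
  [/\ forall x : G, w 0 (phi x) = J1 [::] x,
      forall x : G, w 1 (phi x) = J2 [::] x
    & forall x : G, w 2%:R (phi x) = J3 [::] x].

Lemma rep_fder w J1 J2 J3 i (x : G) : rep w J1 J2 J3 ->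
  [/\ fder i (w 0) (phi x) = s i * J1 [:: i] x,
      fder i (w 1) (phi x) = s i * J2 [:: i] x
    & fder i (w 2%:R) (phi x) = s i * J3 [:: i] x].
Proof.
move=> [[j1 j2 j3] [e1 e2 e3]].
have E (f : form0 M) (J : jets) : is_jet J -> (forall x : G, f (phi x) = J [::]
  x) ->
    fder i f (phi x) = s i * J [:: i] x.
  move=> jJ fJ; apply: fder_pull; rewrite (_ : pull f = J [::]);
    first exact: jJ.
  exact/funext.
by split; apply: E.
Qed.

Lemma rep_curl w J1 J2 J3 : rep w J1 J2 J3 ->
  rep (star2 (d1 w)) (jcurl1 a b c J3 J2 J1) (jcurl2 a b c J1 J3 J2)
    (jcurl3 a b c J2 J1 J3).
Proof.
move=> wJ; have [[j1 j2 j3] [e1 e2 e3]] := wJ; split.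
  by split; apply: is_jetB; (apply: is_jetB || apply: is_jetZ);
    try apply: is_jetZ; try apply: is_jet_shift.
by split=> x; have [f00 f01 f02] := rep_fder 0 x wJ;
  have [f10 f11 f12] := rep_fder 1 x wJ;
  have [f20 f21 f22] := rep_fder 2%:R x wJ;
  have [curl0 curl1 curl2] := curlE a_gt0 b_gt0 c_gt0 sconstM w (phi x);
  [rewrite curl0 f12 f21 e1 | rewrite curl1 f20 f02 e2 | rewrite curl2 f01 f10
    e3].
Qed.

Lemma rep_div w J1 J2 J3 (x : G) : rep w J1 J2 J3 ->
  delta1 w (phi x) = (- 1 *: jdiv a b c J1 J2 J3) [::] x.
Proof.
move=> wJ; have [f00 f01 f02] := rep_fder 0 x wJ.
have [f10 f11 f12] := rep_fder 1 x wJ.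
have [f20 f21 f22] := rep_fder 2%:R x wJ.
rewrite (delta1E a_gt0 b_gt0 c_gt0 sconstM) f00 f11 f22.
rewrite [RHS](_ : _ = - 1 * (a * J1 [:: 0] x + b * J2 [:: 1] x +
    c * J3 [:: 2%:R] x)) //.
by rewrite mulN1r.
Qed.

(** In the frame [delta1] is minus the divergence and [delta2 (d1 w)] is a double curl, so the
    Laplacian is curl curl - grad div, as required by [jet_eigenvalue_bound]. *)
Theorem framed_eigenvalue_bound (w : form1 M) l : l != 0 ->
  (forall i, smooth (w i)) ->
  (forall i g, carrier M g -> hodge_laplacian1 w i g = l * w i g) ->
  (exists i (x : G), w i (phi x) != 0) ->
  [\/ 4 * b ^+ 2 * c ^+ 2 / a ^+ 2 <= l, 4 * a ^+ 2 * c ^+ 2 / b ^+ 2 <= l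
    | 4 * a ^+ 2 * b ^+ 2 / c ^+ 2 <= l] \/
  (a ^+ 2 + b ^+ 2 + c ^+ 2 <= l /\
    ~ forall i (x : G), w i (phi (qopp x)) = w i (phi x)).
Proof.
move=> l0 ws w_eig [i0 [x0 w0]].
pose J i := pull_jet (w i).
have Jj i : is_jet (J i) by apply: is_jet_pull.
have J0 i x : J i [::] x = w i (phi x) by exact: pull_jet0.
have wJ : rep w (J 0) (J 1) (J 2%:R) by split; split.
have cJ := rep_curl wJ; have ccJ := rep_curl cJ; have [_ [c1 c2 c3]] := ccJ.
have Dj : is_jet (- 1 *: jdiv a b c (J 0) (J 1) (J 2%:R)).
  by apply: is_jetZ; do 2?[apply: is_jetD]; apply: is_jetZ; apply: is_jet_shift.
have grad i (x : G) : d0 (delta1 w) i (phi x) =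
    s i * (- 1 *: jdiv a b c (J 0) (J 1) (J 2%:R)) [:: i] x.
  apply: fder_pull; have := Dj [::] i; congr isE; apply/funext => y.
  by rewrite [RHS](rep_div _ wJ).
have lap i (x : G) := w_eig i _ (phi_carrier x).
have main := @jet_eigenvalue_bound R a b c l a_gt0 b_gt0 c_gt0 l0 _ _ _ (Jj 0)
  (Jj 1) (Jj 2%:R).
have [||||?|[le_l noteven]] := main.
- move=> x; rewrite J0 -lap /hodge_laplacian1 grad /delta2 c1.
  rewrite [LHS](_ : _ = jcurl1 a b c (jcurl3 a b c (J 1) (J 0) (J 2%:R))
    (jcurl2 a b c (J 0) (J 2%:R) (J 1)) (jcurl1 a b c (J 2%:R) (J 1) (J 0))
      [::] x
    - a * jdiv a b c (J 0) (J 1) (J 2%:R) [:: 0] x) //.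
  by rewrite -[(- 1 *: _) _ _]/(- 1 * _); rewrite addrC mulrCA mulN1r.
- move=> x; rewrite J0 -lap /hodge_laplacian1 grad /delta2 c2.
  rewrite [LHS](_ : _ = jcurl2 a b c (jcurl1 a b c (J 2%:R) (J 1) (J 0))
    (jcurl3 a b c (J 1) (J 0) (J 2%:R)) (jcurl2 a b c (J 0) (J 2%:R) (J 1))
      [::] x
    - b * jdiv a b c (J 0) (J 1) (J 2%:R) [:: 1] x) //.
  by rewrite -[(- 1 *: _) _ _]/(- 1 * _); rewrite addrC mulrCA mulN1r.
- move=> x; rewrite J0 -lap /hodge_laplacian1 grad /delta2 c3.
  rewrite [LHS](_ : _ = jcurl3 a b c (jcurl2 a b c (J 0) (J 2%:R) (J 1))
    (jcurl1 a b c (J 2%:R) (J 1) (J 0)) (jcurl3 a b c (J 1) (J 0) (J 2%:R))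
      [::] x
    - c * jdiv a b c (J 0) (J 1) (J 2%:R) [:: 2%:R] x) //.
  by rewrite -[(- 1 *: _) _ _]/(- 1 * _); rewrite addrC mulrCA mulN1r.
- exists x0; rewrite !J0; move: i0 w0.
  by apply: ord3P => ->; rewrite ?orbT.
- by left.
right; split=> // w_even; apply: noteven => h.
by rewrite !J0 !w_even.
Qed.

End Pullback.

(** * The spectra *)

Section ConstantForms.
Variables (R : realType) (M : framed_group R).

Lemma fder_cst i k g : @fder R M i (fun=> k) g = 0.
Proof. by rewrite /fder derive1E; apply: derive_val; exact: is_derive_cst. Qed.

Lemma fder_cstE i k : @fder R M i (fun=> k) = fun=> 0.
Proof. by apply/funext => g; apply: fder_cst. Qed.

Lemma smooth_cst k : @smooth R M (fun=> k).
Proof.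
have cc r : {within carrier M, continuous (fun=> r : R)}.
  by move=> x; apply: cvg_cst.
move=> n; elim: n k => [|n IH] k; split=> //.
split=> [i g _|i]; first by case: (is_derive_cst k (0 : R) (1 : R)).
by rewrite fder_cstE.
Qed.

Variables (a b c : R).
Hypotheses (a_gt0 : 0 < a) (b_gt0 : 0 < b) (c_gt0 : 0 < c).
Hypothesis sconstM : sconst M = frame_sconst a b c.

(** Minus the eigenvalue of [star d] on the i-th covector of the invariant coframe; despite the
    name, not a Riemannian curvature. *)
Definition curvature (i : 'I_3) : R :=
  match val i with
  | 0%N => 2 * b * c / a | 1%N => 2 * a * c / b | _ => 2 * a * b / c end.

Lemma curl_cst (e : 'I_3 -> R) : star2 (d1 (fun i (_ : ambient M) => e i)) =
  fun i _ => - curvature i * e i.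
Proof.
apply/funext => i; apply/funext => g; move: i.
have [e0 e1 e2] := curlE a_gt0 b_gt0 c_gt0 sconstM (fun i _ => e i) g.
by apply: ord3P; [rewrite e0 | rewrite e1 | rewrite e2];
  rewrite !fder_cst subrr sub0r mulNr.
Qed.

Lemma hodge_cst (e : 'I_3 -> R) i g :
  hodge_laplacian1 (fun i (_ : ambient M) => e i) i g = curvature i ^+ 2 * e i.
Proof.
have dE : delta1 (fun i (_ : ambient M) => e i) = fun=> 0.
  apply/funext => h; rewrite (delta1E a_gt0 b_gt0 c_gt0 sconstM).
  by rewrite !fder_cst !addr0 oppr0.
by rewrite /hodge_laplacian1 /d0 dE fder_cst add0r /delta2 !curl_cst; ring.
Qed.

Lemma hodge_eigenvalue_cst i g0 : carrier M g0 ->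
  hodge_eigenvalue1 M (curvature i ^+ 2).
Proof.
move=> g0M; exists (fun j _ => (j == i)%:R); split.
- by move=> j; apply: smooth_cst.
- by exists i, g0; rewrite eqxx oner_neq0.
move=> j g _; rewrite (hodge_cst (fun j => (j == i)%:R)).
by case: eqP => [->//|_]; rewrite !mulr0.
Qed.

End ConstantForms.

(** * The trace eigenform of SU(2) and the lower bounds for both groups *)

Section Groups.
Variables (R : realType) (a b c : R).
Hypotheses (a_gt0 : 0 < a) (b_gt0 : 0 < b) (c_gt0 : 0 < c).
Local Notation G := (usphere R).
Local Notation quat := (R * R * R * R)%type.
Local Notation s := (abc a b c).

(** Real parts of matrix coefficients of the defining representation; e_i acts on them by X -> s_i
    E_i X. *)
Let ell (X : 'M[R[i]]_2) : form0 (SU2 a b c) :=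
  fun g => complex.Re (\tr (g *m X)).

Let ellZ (k : R) X g : ell ((k%:C)%C *: X) g = k * ell X g.
Proof.
rewrite /ell -scalemxAr linearZ /=.
by case: (\tr _) => x y /=; rewrite mul0r subr0.
Qed.

Let ellD X Y g : ell (X + Y) g = ell X g + ell Y g.
Proof.
by rewrite /ell mulmxDr linearD /=; case: (\tr _) => ? ?; case: (\tr _).
Qed.

Let ell_qmx y g : ell (qmx y) g = y.1.1.1 * ell 1%:M g + y.1.1.2 * ell (E R 0)
  g +
  y.1.2 * ell (E R 1) g + y.2 * ell (E R 2%:R) g.
Proof.
rewrite -!ellZ -!ellD; congr (ell _ g); rewrite !E_qmx -qmx1 !qmxZ.
move: y => [[[? ?] ?] ?]; apply: mx2P; rewrite !mxE /=;
  by congr (_ +i* _)%C; rewrite /=; ring.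
Qed.

Let is_derive_ell i k X g : is_derive (0 : R) (1 : R)
  (fun t => k * ell X (flow (SU2 a b c) i t g)) (k * s i * ell (E R i *m X) g).
Proof.
have -> : (fun t => k * ell X (flow (SU2 a b c) i t g)) =
    (fun t => (k * ell X g) * cos t + (k * ell (E R i *m X) g) * sin t) \o
    (fun t => s i * t).
  apply/funext => t /=; rewrite /ell /= /expE mulmxDr mulmxDl mul_mx_scalar.
  rewrite -!scalemxAl -!scalemxAr -!scalemxAl -mulmxA linearD !linearZ /=.
  case: (\tr (g *m X)) => p q; case: (\tr _) => u v /=; ring.
have -> : k * s i * ell (E R i *m X) g = k * ell (E R i *m X) g * s i by ring.
apply: is_derive1_comp; last exact: is_derive_mull.
rewrite mulr0.
have := is_deriveD (is_deriveZ (k * ell X g) (is_derive_cos (0 : R)))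
  (is_deriveZ (k * ell (E R i *m X) g) (is_derive_sin (0 : R))).
by rewrite sin0 cos0 oppr0 scaler0 add0r -[_ *: 1]/(_ * 1) mulr1.
Qed.

Let fder_ell i k X : @fder R (SU2 a b c) i (fun g => k * ell X g) =
  fun g => (k * s i) * ell (E R i *m X) g.
Proof.
apply/funext => g; rewrite /fder derive1E; apply: derive_val.
exact: is_derive_ell.
Qed.

Let smooth_ell k X : @smooth R (SU2 a b c) (fun g => k * ell X g).
Proof.
have cc r Y : {within carrier (SU2 a b c), continuous (fun g => r * ell Y g)}.
  have mulc (T : topologicalType) (f : T -> R) :
      continuous f -> continuous (fun x => r * f x).
    by move=> fc x; apply: cvgM; [exact: cvg_cst|exact: fc].
  by apply: continuous_subspaceT; apply: mulc; exact: continuous_Re_mx.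
move=> n; elim: n k X => [|n IH] k X; split=> //.
by split=> [i g _|i]; [case: (is_derive_ell i k X g)|rewrite fder_ell].
Qed.

Ltac gen_ell g := move: (ell 1%:M g) (ell (E R 0) g) (ell (E R 1) g)
  (ell (E R 2%:R) g) => ? ? ? ?.

(** The eigenform is the differential of Re tr g, an odd function on which every E_i^2 is -1. *)
Lemma SU2_hodge_eigenvalue_trace :
  hodge_eigenvalue1 (SU2 a b c) (a ^+ 2 + b ^+ 2 + c ^+ 2).
Proof.
pose w : form1 (SU2 a b c) := fun i g => s i * ell (E R i) g.
have s0 : s 0 = a by []; have s1 : s 1 = b by []; have s2 : s 2%:R = c by [].
have a0 : a != 0 by rewrite gt_eqF.
have b0 : b != 0 by rewrite gt_eqF.
have c0 : c != 0 by rewrite gt_eqF.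
have EE i j g : ell (E R i *m E R j) g = ell (qmx (qmul (qvec i 0 1) (qvec j 0
  1))) g.
  by rewrite !E_qmx qmxM.
have curl0 : star2 (d1 w) = fun i _ => (fun=> 0) i.
  apply/funext => i; apply/funext => g; move: i.
  have [e0 e1 e2] := curlE a_gt0 b_gt0 c_gt0 (erefl : sconst (SU2 a b c) = _) w
    g.
  by apply: ord3P; [rewrite e0 | rewrite e1 | rewrite e2];
    rewrite /w !fder_ell s0 s1 s2 !EE !ell_qmx /=; gen_ell g; field;
    rewrite ?a0 ?b0 ?c0.
have div : delta1 w = fun g => (a ^+ 2 + b ^+ 2 + c ^+ 2) * ell 1%:M g.
  apply/funext => g.
  rewrite (delta1E a_gt0 b_gt0 c_gt0 (erefl : sconst (SU2 a b c) = _)).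
  by rewrite /w !fder_ell s0 s1 s2 !EE !ell_qmx /=; gen_ell g; ring.
exists w; split; first by move=> i; apply: smooth_ell.
  (* At the identity this form vanishes, because the E_i have trace 0. *)
  exists 0, (E R 0); split.
    rewrite /= E_qmx det_qmx; split; first by apply: qmx_unitary;
      apply/eqP/qunit_subproof.
    by rewrite (eqP (qunit_subproof R 0)).
  by rewrite /w s0 /ell E_qmx qmxM tr_qmx /= mulf_neq0.
move=> i g _; rewrite /hodge_laplacian1 /d0 div fder_ell mulmx1 /delta2 curl0.
rewrite (curl_cst a_gt0 b_gt0 c_gt0 (erefl : sconst (SU2 a b c) = _)) mulr0
  addr0.
by rewrite /w; ring.
Qed.

Lemma qmx_continuous (A : 'M[R[i]]_(2, 2)) :
  continuous (fun x : quat => A *m qmx x : 'M[R[i] : numFieldType]_2).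
Proof.
have [c0 c1 c2 c3] := @continuous_coord R.
have N (f : quat -> R) : continuous f -> continuous (fun x => - f x).
  by move=> fc x; apply: cvgN; apply: fc.
have entry i j : continuous (fun x : quat => qmx x i j : (R[i] : numFieldType)).
  move: i j; apply: ord2P; apply: ord2P.
  - rewrite (_ : (fun x => _) = fun x => (x.1.1.1 +i* x.1.1.2)%C).
      exact: continuous_complex.
    by apply/funext => -[[[? ?] ?] ?]; rewrite !mxE.
  - rewrite (_ : (fun x => _) = fun x => (x.1.2 +i* x.2)%C).
      exact: continuous_complex.
    by apply/funext => -[[[? ?] ?] ?]; rewrite !mxE.
  - rewrite (_ : (fun x => _) = fun x => (- x.1.2 +i* x.2)%C).
      by apply: continuous_complex => //; apply: N.
    by apply/funext => -[[[? ?] ?] ?]; rewrite !mxE.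
  rewrite (_ : (fun x => _) = fun x => (x.1.1.1 +i* - x.1.1.2)%C).
    by apply: continuous_complex => //; apply: N.
  by apply/funext => -[[[? ?] ?] ?]; rewrite !mxE.
apply: continuous_mx => i j x; under eq_fun do rewrite mxE sum2.
by apply: (@cvgD (R[i] : numFieldType)); apply: (@cvgM (R[i] : numFieldType));
  [exact: cvg_cst|exact: entry|exact: cvg_cst|exact: entry].
Qed.

Lemma qmul_continuous (y : quat) :
  continuous (fun x : quat => qmul x y) /\ continuous (fun x : quat => qmul y
    x).
Proof.
have D z : continuous (fun x : quat => qdot x z).
  by apply: continuous_qdot => x; [exact: cvg_id|exact: cst_continuous].
move: y => [[[y0 y1] y2] y3]; split.
  rewrite (_ : (fun x => _) = fun x => (qdot x (y0, - y1, - y2, - y3),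
    qdot x (y1, y0, y3, - y2), qdot x (y2, - y3, y0, y1),
    qdot x (y3, y2, - y1, y0))); first exact: continuous_quat.
  by apply/funext => -[[[? ?] ?] ?]; rewrite /qdot /=; congr (_, _, _, _); ring.
rewrite (_ : (fun x => _) = fun x => (qdot x (y0, - y1, - y2, - y3),
  qdot x (y1, y0, - y3, y2), qdot x (y2, y3, y0, - y1),
  qdot x (y3, - y2, y1, y0))); first exact: continuous_quat.
by apply/funext => -[[[? ?] ?] ?]; rewrite /qdot /=; congr (_, _, _, _); ring.
Qed.

Lemma rot_continuous (A : 'M[R]_3) :
  continuous (fun x : quat => A *m rot x).
Proof.
have entry i j : continuous (fun x : quat => rot x i j).
  (* Right multiplications by x and by its conjugate are adjoint, so the entry <x e_j conj(x), e_i>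
     is <x e_j, e_i x>. *)
  rewrite (_ : (fun x => _) = fun x : quat =>
      qdot (qmul x (qvec j 0 1)) (qmul (qvec i 0 1) x)).
    by apply: continuous_qdot;
      [exact: (qmul_continuous (qvec j 0 1)).1|exact: (qmul_continuous (qvec i
        0 1)).2].
  apply/funext => x; rewrite mxE; move: i j x; apply: ord3P; apply: ord3P;
    by move=> [[[? ?] ?] ?]; rewrite /qcoord /qdot /=; ring.
apply: continuous_mx => i j x; under eq_fun do rewrite mxE sum3.
by do 2?[apply: cvgD]; apply: cvgM; [exact: cvg_cst|exact: entry|
  exact: cvg_cst|exact: entry|exact: cvg_cst|exact: entry].
Qed.

Local Notation spectral_bound l :=
  ([\/ 4 * b ^+ 2 * c ^+ 2 / a ^+ 2 <= l, 4 * a ^+ 2 * c ^+ 2 / b ^+ 2 <= l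
    | 4 * a ^+ 2 * b ^+ 2 / c ^+ 2 <= l]).

Lemma SU2_eigenvalue_bound l : hodge_eigenvalue1 (SU2 a b c) l -> l != 0 ->
  spectral_bound l \/ a ^+ 2 + b ^+ 2 + c ^+ 2 <= l.
Proof.
move=> [w [ws [i [g [[gU gdet] wg]]] w_eig]] l0.
(* Translating by g puts a point where the form is nonzero at the quaternion 1. *)
pose phi (x : quat) : ambient (SU2 a b c) := g *m qmx x.
have [||||?|[? _]] := @framed_eigenvalue_bound R a b c a_gt0 b_gt0 c_gt0
  (SU2 a b c) phi erefl _ _ _ w l l0 ws w_eig.
- exact: qmx_continuous.
- move=> x; split; first exact: mul_unitarymx gU (qmx_unitary (usphereP x)).
  by rewrite det_mulmx gdet mul1r det_qmx usphereP.
- by move=> j t x; rewrite /phi /= expE_qmx -mulmxA qmxM.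
- exists i, 1%g; have -> : uval (1%g : G) = (1, 0, 0, 0) by [].
  by rewrite /phi qmx1 mulmx1.
- by left.
by right.
Qed.

Lemma SO3_eigenvalue_bound l : hodge_eigenvalue1 (SO3 a b c) l -> l != 0 ->
  spectral_bound l.
Proof.
move=> [w [ws [i [g [[gO gdet] wg]]] w_eig]] l0.
pose phi (x : quat) : ambient (SO3 a b c) := g *m rot x.
have [||||//|[_ noteven]] := @framed_eigenvalue_bound R a b c a_gt0 b_gt0 c_gt0
  (SO3 a b c) phi erefl _ _ _ w l l0 ws w_eig.
- exact: rot_continuous.
- move=> x; split; last by rewrite det_mulmx gdet det_rot ?mul1r //;
    exact: usphereP.
  rewrite trmx_mul mulmxA -(mulmxA g) rot_orthogonal ?mulmx1 //.
  exact: usphereP.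
- move=> j t x; rewrite /phi /= expE_qmx Ad_qmx; last exact: usphereP.
  by rewrite -mulmxA rotM.
- exists i, 1%g; have -> : uval (1%g : G) = (1, 0, 0, 0) by [].
  by rewrite /phi rot1 mulmx1.
(* Antipodal quaternions give the same rotation, so the lifted form is even. *)
by case: noteven => j x; rewrite /phi /= rot_neg.
Qed.

Lemma SU2_carrier1 : carrier (SU2 a b c) (1%:M : 'M[R[i] : numFieldType]_2).
Proof.
have one1 : qdot (1, 0, 0, 0) (1, 0, 0, 0) = 1 :> R by rewrite /qdot /=; ring.
by rewrite -qmx1; split; [exact: qmx_unitary|rewrite det_qmx one1].
Qed.

Lemma SO3_carrier1 : carrier (SO3 a b c) (1%:M : 'M[R]_3).
Proof. by split; rewrite ?trmx1 ?mulmx1 ?det1. Qed.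

Lemma min_ind (P : R -> Prop) x y : P x -> P y -> P (Num.min x y).
Proof. by move=> Px Py; rewrite minElt; case: ifP. Qed.

Lemma curvature_sqr : [/\
  curvature a b c 0 ^+ 2 = 4 * b ^+ 2 * c ^+ 2 / a ^+ 2,
  curvature a b c 1 ^+ 2 = 4 * a ^+ 2 * c ^+ 2 / b ^+ 2
& curvature a b c 2%:R ^+ 2 = 4 * a ^+ 2 * b ^+ 2 / c ^+ 2].
Proof. by rewrite /curvature /=; split; field; rewrite gt_eqF. Qed.

End Groups.

Unset Implicit Arguments.

Theorem theorem5p5 (R : realType) (a b c : R)
    (ha : 0 < a) (hb : 0 < b) (hc : 0 < c) :
  is_lambda1 (SU2 a b c)
    (Num.min (4 * b ^+ 2 * c ^+ 2 / a ^+ 2)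
      (Num.min (4 * a ^+ 2 * c ^+ 2 / b ^+ 2)
        (Num.min (4 * a ^+ 2 * b ^+ 2 / c ^+ 2)
          (a ^+ 2 + b ^+ 2 + c ^+ 2)))) /\
  is_lambda1 (SO3 a b c)
    (Num.min (4 * b ^+ 2 * c ^+ 2 / a ^+ 2)
      (Num.min (4 * a ^+ 2 * c ^+ 2 / b ^+ 2)
        (4 * a ^+ 2 * b ^+ 2 / c ^+ 2))).
Proof.
have [k0 k1 k2] := curvature_sqr ha hb hc.
have pos (x y z : R) : 0 < x -> 0 < y -> 0 < z -> 0 < 4 * x ^+ 2 * y ^+ 2 / z
  ^+ 2.
  by move=> x0 y0 z0; rewrite divr_gt0 ?mulr_gt0 ?exprn_gt0.
have A0 := pos _ _ _ hb hc ha; have B0 := pos _ _ _ ha hc hb.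
have C0 := pos _ _ _ ha hb hc.
have D0 : 0 < a ^+ 2 + b ^+ 2 + c ^+ 2 by rewrite !addr_gt0 ?exprn_gt0.
split; split.
(* A minimum is one of its entries, so it suffices that each entry is an eigenvalue. *)
- apply: min_ind; last apply: min_ind; last apply: min_ind.
  + by rewrite -k0; apply: hodge_eigenvalue_cst (SU2_carrier1 a b c).
  + by rewrite -k1; apply: hodge_eigenvalue_cst (SU2_carrier1 a b c).
  + by rewrite -k2; apply: hodge_eigenvalue_cst (SU2_carrier1 a b c).
  exact: SU2_hodge_eigenvalue_trace.
- by rewrite gt_eqF // !lt_min A0 B0 C0.
- move=> m /(SU2_eigenvalue_bound ha hb hc) /[apply]; rewrite !ge_min.
  by case=> [[->|->|->]|->]; rewrite ?orbT.
- apply: min_ind; last apply: min_ind.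
  + by rewrite -k0; apply: hodge_eigenvalue_cst (SO3_carrier1 a b c).
  + by rewrite -k1; apply: hodge_eigenvalue_cst (SO3_carrier1 a b c).
  by rewrite -k2; apply: hodge_eigenvalue_cst (SO3_carrier1 a b c).
- by rewrite gt_eqF // !lt_min A0 B0 C0.
move=> m /(SO3_eigenvalue_bound ha hb hc) /[apply]; rewrite !ge_min.
by case=> ->; rewrite ?orbT.
Qed.
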